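(* Let $|A|=n\ge 2$ and let $k\ge 2$. Fix a rank $r\in[1,k-1]$. Then the homology modules of the subposets $A^*_{n,k}([1,k]\setminus\{r\})$ and $A^*_{n,k}([1,k]\setminus\{k-r\})$ are $S_n$-isomorphic.
   Context: $A^*$ is the set of all finite words in the alphabet $A$, $|A|=n$, including the empty word, ordered by the subword order: $u\le v$ if $u$ is obtained from $v$ by deleting letters (not necessarily consecutive). The rank of a word is its length. For $S\subseteq[1,k]=\{1,\dots,k\}$, $A^*_{n,k}(S)$ is the subposet of words with length in $S$; its homology means the reduced simplicial homology, with complex coefficients, of its order complex (any attached bottom or top element is removed first), with $S_n$ acting by permuting the letters of $A$. This homology is concentrated in degree $|S|-1$. *)

(* Defs.v *)
From HB Require Import structures.
From mathcomp Require Import all_boot all_order all_fingroup all_algebra.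
From mathcomp Require Import mxrepresentation.

Set Implicit Arguments.
Unset Strict Implicit.
Unset Printing Implicit Defensive.

Import Order.TTheory GroupScope GRing.Theory.
Local Open Scope ring_scope.

(* Reduced simplicial homology of the order complex of a finite poset T, as a
   representation of a finite group gT acting on T by automorphisms.

   A simplex of the order complex with m vertices is a chain x_1 < ... < x_m,
   stored in increasing order: this is its canonical orientation, and a
   poset automorphism permutes chains without signs.  Everything is indexed by
   the number m of vertices, so the homological degree is m - 1; m = 0 is the
   empty simplex, which spans the augmentation degree -1.  As is usual in
   mxrepresentation, chain groups are spaces of row vectors and operators act
   on the right. *)
Section OrderComplexHomology.

Variables (F : fieldType) (gT : finGroupType) (d : Order.disp_t).
Variables (T : finPOrderType d) (to : {action gT &-> T}).
Hypothesis to_homo : forall g, {homo to^~ g : x y / (x < y)%O}.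

Definition chain (m : nat) := {c : m.-tuple T | sorted <%O c}.

Lemma act_chain_sorted m (c : chain m) g :
  sorted <%O (map_tuple (to^~ g) (val c)).
Proof. exact: homo_sorted (to_homo g) _ (valP c). Qed.

Definition act_chain m (c : chain m) (g : gT) : chain m :=
  Sub (map_tuple (to^~ g) (val c)) (act_chain_sorted c g).

Lemma act_chain1 m (c : chain m) : act_chain c 1%g = c.
Proof.
apply/val_inj/val_inj => /=; rewrite -[RHS]map_id.
by apply: eq_map => x; rewrite act1.
Qed.

Lemma act_chainM m (c : chain m) g h :
  act_chain c (g * h)%g = act_chain (act_chain c g) h.
Proof.
apply/val_inj/val_inj => /=; rewrite -map_comp.
by apply: eq_map => x; rewrite /= actM.
Qed.

Lemma act_chain_inj m g : injective (fun c : chain m => act_chain c g).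
Proof.
move=> c1 c2 /(congr1 (fun c => act_chain c g^-1%g)).
by rewrite -!act_chainM mulgV !act_chain1.
Qed.

Definition chain_mx m (g : gT) : 'M[F]_#|{: chain m}| :=
  \matrix_(i < #|{: chain m}|, j < #|{: chain m}|)
    (act_chain (enum_val i) g == enum_val j)%:R.

Lemma chain_mx_repr m : mx_repr [set: gT] (chain_mx m).
Proof.
split=> [|g h _ _]; apply/matrixP=> i j; rewrite !mxE.
  by rewrite act_chain1 (inj_eq enum_val_inj).
rewrite (bigD1 (enum_rank (act_chain (enum_val i) g))) //= !mxE !enum_rankK.
rewrite eqxx mul1r act_chainM big1 ?addr0 // => l neq_l.
rewrite !mxE [_ == enum_val l]eq_sym (can2_eq enum_valK enum_rankK).
by rewrite (negbTE neq_l) mul0r.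
Qed.

Definition chain_repr m := MxRepresentation (chain_mx_repr m).

Definition delete (l : nat) (s : seq T) := take l s ++ drop l.+1 s.

(* The row of x_0 < ... < x_m is sum_l (-1)^l (x_0 < .. omit x_l .. < x_m). *)
Definition boundary_mx m : 'M[F]_(#|{: chain m.+1}|, #|{: chain m}|) :=
  \matrix_(i < #|{: chain m.+1}|, j < #|{: chain m}|) \sum_(l < m.+1)
     (-1) ^+ l * (delete l (val (enum_val i)) == val (enum_val j) :> seq T)%:R.

Lemma sorted_delete l s : sorted <%O s -> sorted <%O (delete l s).
Proof.
move=> s_sorted; apply: subseq_sorted s_sorted; first exact: lt_trans.
rewrite /delete -{3}(cat_take_drop l s) cat_subseq //.
by rewrite -addn1 addnC -drop_drop drop_subseq.
Qed.

Lemma size_delete m l (s : seq T) :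
  size s = m.+1 -> (l < m.+1)%N -> size (delete l s) = m.
Proof.
move=> s_m lt_l; rewrite size_cat size_take size_drop s_m lt_l.
by rewrite subSS subnKC.
Qed.

(* Cycles: for m = 0 the target of the boundary map is zero. *)
Definition cycles m : 'M[F]_#|{: chain m}| :=
  match m with
  | 0 => 1%:M
  | m'.+1 => kermx (boundary_mx m')
  end.

Definition boundaries m : 'M[F]_#|{: chain m}| := <<boundary_mx m>>%MS.

Lemma boundary_mxJ m g :
  chain_mx m.+1 g *m boundary_mx m = boundary_mx m *m chain_mx m g.
Proof.
apply/matrixP=> i j; rewrite !mxE.
rewrite (bigD1 (enum_rank (act_chain (enum_val i) g))) //= big1 ?addr0; last first.
  move=> l neq_l; rewrite !mxE [_ == enum_val l]eq_sym.
  by rewrite (can2_eq enum_valK enum_rankK) (negbTE neq_l) mul0r.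
rewrite [in RHS](bigD1 (enum_rank (act_chain (enum_val j) g^-1%g))) //=.
rewrite [X in _ = _ + X]big1 ?addr0; last first.
  move=> l neq_l; rewrite !mxE; case: eqP => [actl|]; last by rewrite mulr0.
  case/eqP: neq_l; rewrite -actl -act_chainM mulgV act_chain1.
  by rewrite enum_valK.
rewrite !mxE !enum_rankK eqxx mul1r -act_chainM mulVg act_chain1 eqxx mulr1.
apply: eq_bigr => l _; congr (_ * _%:R); congr nat_of_bool.
rewrite /delete /= -map_take -map_drop -map_cat.
apply/eqP/eqP => [<-|->]; first by rewrite (mapK (actK to g)).
by rewrite (mapK (actKV to g)).
Qed.

Lemma delete_delete (l l' : nat) (s : seq T) :
  (l <= l')%N -> delete l' (delete l s) = delete l (delete l'.+1 s).
Proof.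
rewrite /delete; elim: s l l' => [|x s IHs] [|l] [|l'] //=.
- by rewrite !drop0 take0.
- by rewrite !drop0.
by rewrite ltnS => le_l; congr cons; apply: IHs.
Qed.

Lemma boundary_mx_sq m : boundary_mx m.+1 *m boundary_mx m = 0.
Proof.
apply/matrixP=> i j; rewrite !mxE.
pose c := val (val (enum_val i)); pose c' := val (val (enum_val j)).
pose t (p : 'I_m.+2 * 'I_m.+1) : F :=
  (-1) ^+ (p.1 + p.2) * (delete p.2 (delete p.1 c) == c')%:R.
transitivity (\sum_p t p).
  under eq_bigr => h _ do rewrite !mxE big_distrlr /=.
  rewrite exchange_big /= -(pair_bigA _ (fun l l' => t (l, l'))) /=.
  apply: eq_bigr => l _; rewrite exchange_big /=; apply: eq_bigr => l' _.
  have size_del: size (delete l c) == m.+1.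
    by rewrite (@size_delete m.+1) // size_tuple.
  pose h : chain m.+1 := Sub (Tuple size_del)
    (sorted_delete l (valP (enum_val i)) : sorted <%O (Tuple size_del)).
  rewrite (bigD1 (enum_rank h)) //= big1 ?addr0 => [|h' neq_h].
    by rewrite /t !enum_rankK /= eqxx mulr1 exprD mulrA.
  case: eqP => [del_c|]; last by rewrite mulr0 mul0r.
  case/eqP: neq_h; rewrite -[h']enum_valK; congr enum_rank.
  by apply/val_inj/val_inj; rewrite /= -del_c.
rewrite (bigID (fun p : 'I_m.+2 * 'I_m.+1 => (p.1 <= p.2)%N)) /=.
pose f (p : 'I_m.+2 * 'I_m.+1) : 'I_m.+2 * 'I_m.+1 :=
  (lift ord0 p.2, inord p.1).
pose f' (p : 'I_m.+2 * 'I_m.+1) : 'I_m.+2 * 'I_m.+1 :=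
  (widen_ord (leqnSn _) p.2, inord p.1.-1).
have fK (p : 'I_m.+2 * 'I_m.+1) : ~~ (p.1 <= p.2)%N -> f (f' p) = p.
  case: p => l l' /=; rewrite -ltnNge => lt_l; rewrite /f /f' /=.
  have l_gt0 : (0 < l)%N by apply: leq_trans lt_l.
  congr pair; apply: val_inj => /=; last by rewrite inordK.
  rewrite inordK; first by rewrite /bump /= add1n prednK.
  by rewrite prednK // -ltnS ltn_ord.
rewrite [X in _ + X](reindex_onto f f' fK) /=.
rewrite [X in _ + X](eq_bigl (fun p : 'I_m.+2 * 'I_m.+1 => (p.1 <= p.2)%N)) /=; last first.
  case=> l l' /=; rewrite -ltnNge /bump /= add1n ltnS.
  apply/andP/idP => [[+ /eqP[/(congr1 val) /= eq_l _]]|le_l].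
    by rewrite eq_l.
  have lt_l : (l < m.+1)%N by apply: leq_ltn_trans le_l (ltn_ord l').
  rewrite inordK //; split=> //; apply/eqP; congr pair; apply: val_inj => /=.
    by rewrite inordK.
  by rewrite inordK ?ltn_ord.
rewrite -big_split big1 //= => -[l l'] /= le_l.
have lt_l : (l < m.+1)%N by apply: leq_ltn_trans le_l (ltn_ord l').
rewrite /t /= inordK // /bump /= add1n delete_delete // addSn addnC exprS.
by rewrite mulN1r mulNr subrr.
Qed.

(* section_repr does not itself ask for this inclusion. *)
Lemma boundaries_sub_cycles m : (boundaries m <= cycles m)%MS.
Proof.
rewrite genmxE; case: m => [|m] /=; first exact: submx1.
by apply/sub_kermxP; apply: boundary_mx_sq.
Qed.

Lemma cycles_module m : mxmodule (chain_repr m) (cycles m).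
Proof.
apply/mxmoduleP=> g _; case: m => [|m] /=; first exact: submx1.
by apply/sub_kermxP; rewrite -mulmxA boundary_mxJ mulmxA mulmx_ker mul0mx.
Qed.

Lemma boundaries_module m : mxmodule (chain_repr m) (boundaries m).
Proof.
rewrite (eqmx_module _ (genmxE _)); apply/mxmoduleP=> g _ /=.
by rewrite -boundary_mxJ submxMl.
Qed.

(* cycles m / boundaries m: the reduced homology in degree m - 1. *)
Definition homology_repr m : mx_representation F [set: gT] _ :=
  section_repr (boundaries_module m) (cycles_module m).

End OrderComplexHomology.

Fact subword_display : Order.disp_t. Proof. exact: Order.Disp tt tt. Qed.

(* A^*_{n,k}(S), with n = #|A|; k.-bseq A is the type of words of length <= k. *)
Definition words (A : finType) (k : nat) (S : pred nat) :=
  {w : k.-bseq A | S (size w)}.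

Section Words.

Variables (A : finType) (k : nat) (S : pred nat).
Local Notation words := (words A k S).

HB.instance Definition _ := Finite.on words.

Definition subword (u v : words) := subseq (val u) (val v).

Lemma subword_refl : reflexive subword.
Proof. by move=> u; apply: subseq_refl. Qed.

Lemma subword_anti : antisymmetric subword.
Proof.
move=> u v /andP[uv vu]; apply/val_inj/val_inj/eqP.
by rewrite -(geq_leqif (size_subseq_leqif uv)) size_subseq.
Qed.

Lemma subword_trans : transitive subword.
Proof. by move=> v u w; apply: subseq_trans. Qed.

HB.instance Definition _ := Order.Le_isPOrder.Build subword_display words
  subword_refl subword_anti subword_trans.

Lemma act_word_proof (w : words) (s : {perm A}) : S (size (map_bseq s (val w))).
Proof. by rewrite size_map (valP w). Qed.

(* This is a right action, as the product of {perm A} is (s * t) x = t (s x). *)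
Definition act_word (w : words) (s : {perm A}) : words :=
  Sub (map_bseq s (val w)) (act_word_proof w s).

Lemma act_word1 : act_word^~ 1%g =1 id.
Proof.
move=> w; apply/val_inj/val_inj => /=; rewrite -[RHS]map_id.
by apply: eq_map => x; rewrite perm1.
Qed.

Lemma act_wordM (w : words) : act_morph act_word w.
Proof.
move=> s t; apply/val_inj/val_inj => /=; rewrite -map_comp.
by apply: eq_map => x; rewrite /= permM.
Qed.

Canonical word_action := TotalAction act_word1 act_wordM.

Lemma word_action_homo s :
  {homo word_action^~ s : u v / (u < v)%O >-> (u < v)%O}.
Proof.
move=> u v /=; rewrite !lt_neqAle => /andP[neq_uv le_uv]; apply/andP; split.
  by apply: contra neq_uv => /eqP/(act_inj word_action)->.
exact: (map_subseq s).
Qed.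


End Words.

(* The S_n-module ~H_{m-1}(A^*_{n,k}(S); F), where S_n = {perm A}. *)
Definition words_homology_repr (F : fieldType) (A : finType) (k : nat)
    (S : pred nat) (m : nat) : mx_representation F [set: {perm A}] _ :=
  homology_repr F (@word_action_homo A k S) m.

(* Main.v *)
Require Import Defs.
From mathcomp Require Import all_boot all_fingroup all_algebra.
From mathcomp Require Import mxrepresentation reals complex.
From mathcomp Require Import all_order pgroup character zify ring.

(* Removing a rank from the word poset leaves homology only in the top degree
   k - 2, so over a field of characteristic 0 the module is determined by the
   Lefschetz numbers of the chain complex.  A chain is fixed by a permutation
   exactly when all its words use fixed letters only, so for a permutation with
   b fixed letters one counts chains of words over b letters; up to terms
   independent of r their signed number is b (1 - b)^(k - 1) C(k, r), which is
   symmetric under r -> k - r.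

   For the concentration, embed all words of length at most k in one long word
   w0.  A chain extends greedily to a maximal chain from w0 to the empty word:
   at each step delete the leftmost letter that keeps the next word of the chain
   a subword.  The chains with a given extension are those which contain its
   descents, so they form an interval in the Boolean lattice, and adding or
   removing a non-descent of admissible length matches them off; this is the
   lexicographic shelling of subword order. *)

Set Implicit Arguments.
Unset Strict Implicit.
Unset Printing Implicit Defensive.

Import Order.TTheory GroupScope GRing.Theory.

(** * Greedy deletion paths in subword order *)

Section LetterDeletion.

Variable A : eqType.
Implicit Types (x y u : seq A) (p q i j l : nat).

Definition del p x := take p x ++ drop p.+1 x.

Lemma size_del p x : (p < size x)%N -> size (del p x) = (size x).-1.
Proof. by move=> lt_p; rewrite size_cat size_take size_drop lt_p; lia. Qed.

Lemma subseq_del p x : subseq (del p x) x.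
Proof.
rewrite /del -{3}(cat_take_drop p x) cat_subseq //.
by rewrite -addn1 addnC -drop_drop drop_subseq.
Qed.

Lemma del_cat p x y : (p < size x)%N -> del p (x ++ y) = del p x ++ y.
Proof.
move=> lt_p; rewrite /del takel_cat ?(ltnW lt_p) // drop_cat.
have [_|le_S] := ltnP p.+1 (size x); first by rewrite catA.
have -> : p.+1 = size x by apply/eqP; rewrite eqn_leq lt_p.
by rewrite subnn drop0 drop_size cats0.
Qed.

Lemma del_cons p a x : del p.+1 (a :: x) = a :: del p x.
Proof. by []. Qed.

Lemma subseq_del_del p q x : (p < q)%N ->
  subseq (del p (del q x)) (del p x).
Proof.
elim: x p q => [|a x IHx] [|p] [|q] //= lt_pq.
  by rewrite del_cons /del /= !drop0 subseq_del.
by rewrite !del_cons /= eqxx IHx.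
Qed.

Lemma exists_del x y : subseq y x -> (size y < size x)%N ->
  exists2 p, (p < size x)%N & subseq y (del p x).
Proof.
elim: x y => [|a x IHx] [|b y] //= sub_yx lt_yx.
  by exists 0%N; rewrite ?sub0seq.
case: eqP sub_yx => [->|_] sub_yx; last by exists 0%N => //; rewrite /del /= drop0.
have [p lt_p sub_p] := IHx y sub_yx lt_yx.
by exists p.+1; rewrite // del_cons /= eqxx.
Qed.

Lemma subseq_catP y x1 x2 : subseq y (x1 ++ x2) ->
  exists y1 y2, [/\ y = y1 ++ y2, subseq y1 x1 & subseq y2 x2].
Proof.
case/subseqP=> m sz_m ->; rewrite -(cat_take_drop (size x1) m).
have sz : size (take (size x1) m) = size x1.
  by rewrite size_takel // sz_m size_cat leq_addr.
by rewrite mask_cat //; do 2!eexists; split; [reflexivity| |]; apply: mask_subseq.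
Qed.

(** Let [a] be the letter of [x] at [q]: [x = u a z], and [y = y1 y2] with [y1] inside [u], [y2]
    inside [z]. If [y1] is shorter than [u], some letter of [u] can go. Otherwise [y] begins with
    [u], and in an embedding into [del p x] the part [c1] cannot fill [del p (u a)], or both
    deletions would give the same word; so [c1] is a proper prefix of [u] and the letter after it
    can go. *)
Lemma del_exchange p q x y :
    (p < q)%N -> (q < size x)%N -> del p x != del q x ->
    subseq y (del p x) -> subseq y (del q x) ->
  exists2 p', (p' < q)%N & subseq y (del p' (del q x)).
Proof.
move=> lt_pq lt_qx ne_del sub_yp sub_yq; set u := take q x; set z := drop q.+1 x.
have sz_u : size u = q by rewrite size_takel // ltnW.
have [a def_x] : exists a, x = rcons u a ++ z.
  case: x lt_qx @u @z sz_u {ne_del sub_yp sub_yq} => // b x lt_qx u z sz_u.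
  exists (nth b (b :: x) q); rewrite cat_rcons -drop_nth //.
  by rewrite cat_take_drop.
have [y1 [y2 [def_y sub_y1 sub_y2]]] := subseq_catP sub_yq.
have [/eqP sz_y1|] := boolP (size y1 == q); last first.
  move=> ne_sz; have lt_sz : (size y1 < size u)%N.
    by rewrite ltn_neqAle {1}sz_u ne_sz size_subseq.
  have [p' lt_p' sub_p'] := exists_del sub_y1 lt_sz.
  rewrite sz_u in lt_p'; exists p' => //.
  by rewrite def_y [del q x]/(u ++ z) del_cat ?sz_u // cat_subseq.
have def_y1 : y1 = u.
  by apply/eqP; rewrite -(geq_leqif (size_subseq_leqif sub_y1)) sz_u sz_y1.
have lt_pu : (p < size u)%N by rewrite sz_u.
have lt_pr : (p < size (rcons u a))%N by rewrite size_rcons ltnW.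
move: sub_yp; rewrite {1}def_x del_cat //.
case/subseq_catP=> c1 [c2 [def_y' sub_c1 sub_c2]].
have sz_r : size (del p (rcons u a)) = q by rewrite size_del // size_rcons sz_u.
have := size_subseq sub_c1; rewrite sz_r leq_eqVlt => /predU1P[sz_c1|lt_c1].
  case/eqP: ne_del; rewrite {1}def_x del_cat //; congr (_ ++ _).
  have /eqP <- : c1 == del p (rcons u a).
    by rewrite -(geq_leqif (size_subseq_leqif sub_c1)) sz_r sz_c1.
  have := congr1 (take q) def_y'; rewrite def_y def_y1.
  by rewrite !take_size_cat.
exists (size c1) => //; rewrite def_y' [del q x]/(u ++ z) del_cat ?sz_u //.
rewrite cat_subseq //.
have <- : take (size c1) u = c1.
  have := congr1 (take (size c1)) def_y'; rewrite def_y def_y1.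
  by rewrite takel_cat ?sz_u ?(ltnW lt_c1) // take_size_cat.
by rewrite size_takel ?sz_u ?(ltnW lt_c1) // prefix_subseq.
Qed.

(* The value is [size x] when y is not a proper subword of x. *)
Definition greedy_pos x y := find (fun p => subseq y (del p x)) (iota 0 (size x)).

Lemma greedy_pos_le x y p : subseq y (del p x) -> (greedy_pos x y <= p)%N.
Proof.
move=> sub_y; rewrite leqNgt; apply/negP=> lt_p.
have := before_find 0%N lt_p; rewrite nth_iota ?add0n ?sub_y //.
by rewrite (leq_trans lt_p) // (leq_trans (find_size _ _)) ?size_iota.
Qed.

Lemma greedy_posP x y : subseq y x -> (size y < size x)%N ->
  (greedy_pos x y < size x)%N /\ subseq y (del (greedy_pos x y) x).
Proof.
move=> sub_yx lt_yx; have [p lt_p sub_p] := exists_del sub_yx lt_yx.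
have lt_g := leq_ltn_trans (greedy_pos_le sub_p) lt_p.
split=> //; have hs : has (fun p => subseq y (del p x)) (iota 0 (size x)).
  by apply/hasP; exists p; rewrite ?mem_iota.
by have := nth_find 0%N hs; rewrite -/(greedy_pos x y) nth_iota.
Qed.

(** A larger target leaves fewer admissible deletions; if it leaves none, the value is [size x], the
    largest possible. *)
Lemma greedy_pos_mono x y y' : subseq y y' -> (greedy_pos x y <= greedy_pos x y')%N.
Proof.
pose P q := subseq y' (del q x).
move=> sub_y; have [hs|] := boolP (has P (iota 0 (size x))).
  apply: greedy_pos_le; apply: subseq_trans sub_y _.
  have := nth_find 0%N hs; rewrite -/(greedy_pos x y') nth_iota //.
  by rewrite -[ltnRHS](size_iota 0) -has_find.
move/hasNfind; rewrite size_iota -/(greedy_pos x y') => ->.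
by rewrite (leq_trans (find_size _ _)) ?size_iota.
Qed.

Section LocallyGreedyPath.

Variables (X : nat -> seq A) (p : nat -> nat) (n : nat).
Hypothesis p_lt : forall i, (i < n)%N -> (p i < size (X i))%N.
Hypothesis X_S : forall i, (i < n)%N -> X i.+1 = del (p i) (X i).
Hypothesis p_min : forall i, (i < n)%N -> greedy_pos (X i) (X i.+1) = p i.

Lemma path_subseq i j : (i <= j <= n)%N -> subseq (X j) (X i).
Proof.
elim: j => [|j IHj] /andP[]; first by rewrite leqn0 => /eqP->.
rewrite leq_eqVlt => /predU1P[->//|le_ij] lt_jn.
rewrite X_S //; apply: subseq_trans (subseq_del _ _) (IHj _).
by rewrite -ltnS le_ij ltnW.
Qed.

(* If some p' < p i were possible, the exchange lemma would give a deletion at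
   the left of p i inside X i.+1, hence a descent at X i.+1. *)
Lemma locally_greedy_path i j : (i < j <= n)%N ->
    (forall k, (i <= k)%N -> (k.+1 < j)%N -> greedy_pos (X k) (X k.+2) = p k) ->
  greedy_pos (X i) (X j) = p i.
Proof.
move=> /andP[]; have [m def_m] := ubnPeq (j - i.+1)%N; move: def_m.
elim: m i j => [|m IHm] i j def_m.
  move=> lt_ij le_jn _; have -> : j = i.+1 by lia.
  by apply: p_min; lia.
move=> lt_ij le_jn greedy2.
have lt_Sij : (i.+1 < j)%N by lia.
have lt_in : (i < n)%N by lia.
have lt_Sin : (i.+1 < n)%N by lia.
have IH : greedy_pos (X i.+1) (X j) = p i.+1.
  by apply: IHm => //; [lia | move=> k le_ik; apply: greedy2; lia].
have sub_Sij : subseq (X j) (X i.+1) by apply: path_subseq; lia.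
have sub_ij : subseq (X j) (X i) by apply: path_subseq; lia.
apply/eqP; rewrite eqn_leq greedy_pos_le -?X_S //= leqNgt; apply/negP=> lt_g.
have lt_sz : (size (X j) < size (X i))%N.
  apply: leq_ltn_trans (size_subseq sub_Sij) _.
  by rewrite (X_S lt_in) (size_del (p_lt lt_in)); have := p_lt lt_in; lia.
have [_ sub_g] := greedy_posP sub_ij lt_sz.
have ne_del : del (greedy_pos (X i) (X j)) (X i) != del (p i) (X i).
  apply: contraL lt_g => /eqP def_del; rewrite -leqNgt -{1}p_min // greedy_pos_le //.
  by rewrite X_S // def_del.
have sub_Sij' : subseq (X j) (del (p i) (X i)) by rewrite -X_S.
have [p' lt_p' sub_p'] := del_exchange lt_g (p_lt lt_in) ne_del sub_g sub_Sij'.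
rewrite -X_S // in sub_p'; have := greedy_pos_le sub_p'; rewrite IH => le_p'.
(* Deleting position [p i.+1] of [X i] first also keeps [X i.+2], so the greedy position towards
   [X i.+2] would be below [p i]. *)
have lt_pp : (p i.+1 < p i)%N by lia.
have : (greedy_pos (X i) (X i.+2) <= p i.+1)%N.
  by apply: greedy_pos_le; rewrite X_S // (X_S lt_in) subseq_del_del.
by rewrite greedy2 ?leqnn //; lia.
Qed.

End LocallyGreedyPath.

Implicit Types (G H : seq (seq A)) (t : nat -> seq A).

(* G is meant to be sorted, so this is the longest word of G shorter than l;
   the default [::] is the final target. *)
Definition next_target G l := last [::] [seq g <- G | (size g < l)%N].

Lemma next_target_mem G l : next_target G l \in [::] :: G.
Proof.
rewrite /next_target; move: (mem_last ([::] : seq A) [seq g <- G | (size g < l)%N]).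
by rewrite !inE mem_filter => /orP[->//|/andP[_ ->]]; rewrite orbT.
Qed.

Lemma size_next_target G l : (0 < l)%N -> (size (next_target G l) < l)%N.
Proof.
move=> l_gt0; rewrite /next_target.
move: (mem_last ([::] : seq A) [seq g <- G | (size g < l)%N]).
by rewrite inE mem_filter => /predU1P[->//|/andP[]].
Qed.

Lemma next_target_max G g l :
  sorted subseq G -> g \in G -> (size g < l)%N -> subseq g (next_target G l).
Proof.
move=> G_sorted Gg lt_g; rewrite /next_target.
have : sorted subseq [seq g <- G | (size g < l)%N].
  exact: (sorted_filter (@subseq_trans A)).
have : g \in [seq g <- G | (size g < l)%N] by rewrite mem_filter lt_g.
elim/last_ind: [seq _ <- _ | _] => // s h _; rewrite last_rcons mem_rcons inE.
case/predU1P=> [->//|sg]; rewrite -cats1 (sorted_pairwise (@subseq_trans A)).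
by rewrite pairwise_cat allrel1r => /andP[/allP/(_ g sg)].
Qed.

Lemma next_target_mono G H l : {subset G <= H} -> sorted subseq H ->
  subseq (next_target G l) (next_target H l).
Proof.
move=> sGH H_sorted; have [->|l_gt0] := posnP l.
  by rewrite /next_target (eq_filter (a2 := pred0)) ?filter_pred0 ?sub0seq.
have := next_target_mem G l; rewrite inE => /predU1P[->|Gt]; first exact: sub0seq.
by apply: next_target_max; rewrite ?sGH ?size_next_target.
Qed.

Definition greedy_step t x := del (greedy_pos x (t (size x))) x.

(** The edge labels of the lexicographic shelling: the positions deleted along a greedy path. *)
Fixpoint labels t n x : seq nat :=
  if n is n'.+1
  then greedy_pos x (t (size x)) :: labels t n' (greedy_step t x) else [::].

Lemma size_labels t n x : size (labels t n x) = n.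
Proof. by elim: n x => //= n IHn x; rewrite IHn. Qed.

(** The path can be recovered from its labels, so that data chosen from the path depend on the
    labels only. *)
Lemma foldl_labels t n x i : (i <= n)%N ->
  foldl (fun y p => del p y) x (take i (labels t n x)) = iter i (greedy_step t) x.
Proof.
elim: n x i => [|n IHn] x [|i] //= le_i.
by rewrite IHn // -iterSr.
Qed.

Lemma nth_labels t n x i : (i < n)%N ->
  nth 0%N (labels t n x) i =
    greedy_pos (iter i (greedy_step t) x) (t (size (iter i (greedy_step t) x))).
Proof. by elim: n x i => [|n IHn] x [|i] //= lt_i; rewrite IHn // -iterSr. Qed.

(** The first labels compare by monotonicity; if they are equal, both paths move to the same word
    and the comparison continues there. *)
Lemma labels_le t t' n x : (forall l, subseq (t l) (t' l)) ->
  (labels t n x <= labels t' n x :> seqlexi nat)%O.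
Proof.
move=> le_t; elim: n x => [|n IHn] x //=.
rewrite lexi_cons; have := greedy_pos_mono x (le_t (size x)); rewrite -leEnat => le_g.
rewrite le_g /=; apply/implyP=> ge_g; rewrite /greedy_step.
have -> : greedy_pos x (t (size x)) = greedy_pos x (t' (size x)).
  by apply/le_anti; rewrite le_g.
exact: IHn.
Qed.

(** * The greedy path through a given chain *)

Section GreedyPath.

Variables (w0 : seq A) (G : seq (seq A)).
Hypothesis G_sorted : sorted subseq G.
Hypothesis G_sub : forall g, g \in G -> subseq g w0 && (size g < size w0)%N.

Let n := size w0.
Let X i := iter i (greedy_step (next_target G)) w0.
Let p i := greedy_pos (X i) (next_target G (size (X i))).

(** Each step keeps its target, the longest shorter word of [G], and with it all shorter words of
    [G], since [G] is a chain. *)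
Lemma greedy_path_inv i : (i <= n)%N ->
  size (X i) = (n - i)%N /\
  (forall g, g \in G -> (size g <= n - i)%N -> subseq g (X i)).
Proof.
elim: i => [|i IHi] le_in; first by rewrite subn0; split=> // g /G_sub/andP[].
have [sz_X sub_X] := IHi (ltnW le_in).
have sz_t : (size (next_target G (size (X i))) < size (X i))%N.
  by rewrite size_next_target // sz_X subn_gt0.
have sub_t : subseq (next_target G (size (X i))) (X i).
  have := next_target_mem G (size (X i)); rewrite inE => /predU1P[->|Gt].
    exact: sub0seq.
  by rewrite sub_X // -sz_X ltnW.
have [lt_p sub_p] := greedy_posP sub_t sz_t.
rewrite [X i.+1]/(del _ (X i)); split; first by rewrite size_del // sz_X subnS.
move=> g Gg sz_g; apply: subseq_trans sub_p; apply: next_target_max => //.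
by rewrite sz_X; lia.
Qed.

Lemma size_greedy_path i : (i <= n)%N -> size (X i) = (n - i)%N.
Proof. by case/greedy_path_inv. Qed.

Lemma greedy_path_tgt i : (i < n)%N ->
  (p i < size (X i))%N /\ subseq (next_target G (size (X i))) (X i.+1).
Proof.
move=> lt_in; have [sz_X sub_X] := greedy_path_inv (ltnW lt_in).
have l_gt0 : (0 < size (X i))%N by rewrite sz_X subn_gt0.
have sub_t : subseq (next_target G (size (X i))) (X i).
  have := next_target_mem G (size (X i)); rewrite inE => /predU1P[->|Gt].
    exact: sub0seq.
  by rewrite sub_X // -sz_X ltnW // size_next_target.
exact: greedy_posP sub_t (size_next_target _ l_gt0).
Qed.

(** When the path has come down to length [size g], its word still contains [g] and so equals it. *)
Lemma greedy_path_mem g : g \in G -> g = X (n - size g).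
Proof.
move=> Gg; have /andP[sub_g lt_g] := G_sub Gg.
have [sz_X sub_X] := greedy_path_inv (leq_subr (size g) n).
rewrite subKn ?(ltnW lt_g) // in sz_X sub_X.
by apply/eqP; rewrite -(geq_leqif (size_subseq_leqif (sub_X g Gg (leqnn _)))) sz_X.
Qed.

Let p_lt i : (i < n)%N -> (p i < size (X i))%N.
Proof. by case/greedy_path_tgt. Qed.

Let X_S i : (i < n)%N -> X i.+1 = del (p i) (X i).
Proof. by []. Qed.

Let p_min i : (i < n)%N -> greedy_pos (X i) (X i.+1) = p i.
Proof.
move=> lt_in; apply/eqP; rewrite eqn_leq greedy_pos_le //= greedy_pos_mono //.
by case: (greedy_path_tgt lt_in).
Qed.

Lemma greedy_path_subseq i j : (i <= j <= n)%N -> subseq (X j) (X i).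
Proof. exact: path_subseq X_S _ _. Qed.

(** The target at [X i] is empty or a word of [G] on the path, and it is not [X i.+1]; so it lies at
    or below [X i.+2], and monotonicity applies. Thus all descents of the path lie in [G]. *)
Lemma greedy_path_ascent i : (i.+1 < n)%N -> X i.+1 \notin G ->
  greedy_pos (X i) (X i.+2) = p i.
Proof.
move=> lt_in GX; have lt_i : (i < n)%N by apply: ltnW.
have sub_X : subseq (X i.+2) (X i.+1) by apply: greedy_path_subseq; lia.
apply/eqP; rewrite eqn_leq (greedy_pos_le sub_X) andTb.
apply: greedy_pos_mono; set t := next_target _ _.
have lt_t : (size t < n - i)%N.
  by rewrite -size_greedy_path ?size_next_target ?size_greedy_path ?subn_gt0 // ltnW.
have := next_target_mem G (size (X i)); rewrite -/t inE => /predU1P[->|Gt].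
  exact: sub0seq.
have := greedy_path_mem Gt; set j := (n - size t)%N => def_t.
rewrite def_t; apply: greedy_path_subseq; rewrite leq_subr andbT.
have : j != i.+1 by apply: contraNneq GX => <-; rewrite -def_t.
by rewrite /j; lia.
Qed.

(* A set H of words on the path of G which contains all its descents has the
   same greedy path. *)
Lemma labels_eq_path H :
    sorted subseq H ->
    (forall h, h \in H -> (size h <= n)%N /\ h = X (n - size h)) ->
    (forall i, (i.+1 < n)%N -> X i.+1 \notin H -> greedy_pos (X i) (X i.+2) = p i) ->
  labels (next_target H) n w0 = labels (next_target G) n w0.
Proof.
move=> H_sorted HX asc.
have tgtH i : (i < n)%N -> greedy_pos (X i) (next_target H (size (X i))) = p i.
  move=> lt_in; set t := next_target _ _; have sz_X := size_greedy_path (ltnW lt_in).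
  have lt_t : (size t < n - i)%N by rewrite -sz_X size_next_target // sz_X subn_gt0.
  have [le_tn def_t] : (size t <= n)%N /\ t = X (n - size t).
    have := next_target_mem H (size (X i)); rewrite -/t inE => /predU1P[->|/HX//].
    split=> //; apply/esym/size0nil; rewrite size_greedy_path subn0 ?subnn //.
  (* Strictly between [X i] and its target the path meets no word of [H], which would be a longer
     target; so all words there are ascents. *)
  rewrite {1}def_t; apply: (locally_greedy_path p_lt X_S p_min); first lia.
  move=> k le_ik lt_k; apply: asc; first lia.
  apply/negP=> HXk; have lt_k' : (k.+1 <= n)%N by lia.
  have sz_k : size (X k.+1) = (n - k.+1)%N by apply: size_greedy_path.
  have lt_ki : (size (X k.+1) < size (X i))%N by rewrite sz_k sz_X; lia.
  have := size_subseq (next_target_max H_sorted HXk lt_ki); rewrite -/t sz_k; lia.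
have XH i : (i <= n)%N -> iter i (greedy_step (next_target H)) w0 = X i.
  elim: i => //= i IHi lt_in; rewrite IHi ?(ltnW lt_in) //.
  by rewrite /greedy_step tgtH.
apply: (@eq_from_nth _ 0%N) => [|i]; rewrite !size_labels // => lt_in.
by rewrite !nth_labels // XH ?(ltnW lt_in) // tgtH.
Qed.

End GreedyPath.
End LetterDeletion.

Local Open Scope ring_scope.

(** * Representations are determined by their traces *)

(** With [E = C R] a full rank factorization, idempotence forces [R C = 1], and [C R] and [R C] have
    equal traces. *)
Lemma mxtrace_idem (F : fieldType) n (E : 'M[F]_n) :
  E *m E = E -> \tr E = (\rank E)%:R.
Proof.
move: (row_base_free E) (col_base_full E) (mulmx_base E).
move: (row_base E) (col_base E) => R C freeR fullC defE idE.
rewrite -{1}defE mxtrace_mulC -mxtrace1; congr (\tr _).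
apply: (row_free_inj freeR); apply: (row_full_inj fullC).
rewrite mul1mx /= 2!mulmxA -mulmxA defE. by [].
Qed.

Section TraceDeterminesRepr.

Variables (F : closedFieldType) (gT : finGroupType) (G : {group gT}).
Hypothesis char0 : [pchar F] =i pred0.
Let sG : irrType F G := DecSocleType (regular_repr F G).

Let F'G : [pchar F]^'.-group G.
Proof. by apply/pgroupP=> p _ _; rewrite inE /= char0. Qed.

Lemma gring_op_submod n (rG : mx_representation F G n) U (modU : mxmodule rG U)
    A : (A \in group_ring F G)%MS ->
  val_submod 1%:M *m gring_op rG A
    = gring_op (submod_repr modU) A *m val_submod 1%:M.
Proof.
have hS x : x \in G ->
    val_submod 1%:M *m rG x = submod_repr modU x *m val_submod 1%:M.
  by move=> Gx; rewrite -[RHS]val_submodE -[submod_repr modU x]mul1mx val_submodJ.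
move: (val_submod 1%:M) hS => S hS /envelop_mxP[a ->].
rewrite !linear_sum mulmx_suml; apply: eq_bigr => x Gx.
by rewrite !linearZ /= -scalemxAl !gring_opG // hS.
Qed.

Lemma mxtrace_gring_op n1 n2 (rG1 : mx_representation F G n1)
    (rG2 : mx_representation F G n2) A :
  {in G, forall g, \tr (rG1 g) = \tr (rG2 g)} -> (A \in group_ring F G)%MS ->
  \tr (gring_op rG1 A) = \tr (gring_op rG2 A).
Proof.
move=> eq_tr /envelop_mxP[a ->]; rewrite !linear_sum /=.
by apply: eq_bigr => x Gx; rewrite !linearZ /= !gring_opG // eq_tr.
Qed.

Let e_ (i : sG) := Wedderburn_id i.

Lemma gring_op_irr_comp n (rG : mx_representation F G n) :
  mx_irreducible rG -> gring_op rG (e_ (irr_comp sG rG)) = 1%:M.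
Proof.
move=> irrG; rewrite -[RHS](gring_op1 rG) -(Wedderburn_sum_id_pchar sG F'G).
rewrite linear_sum (bigD1 (irr_comp sG rG)) //= big1 ?addr0 // => j ne_j.
exact: (irr_comp'_op0_pchar F'G irrG ne_j (Wedderburn_id_mem j)).
Qed.

(** For a group element [g], [e_ i *m g] lies in the Wedderburn ideal of [i], where [e_ i] is a
    right unit; so the image of [e_ i] is stable. *)
Lemma gring_op_Wedderburn_module n (rG : mx_representation F G n) i :
  mxmodule rG (gring_op rG (e_ i)).
Proof.
have [_ Ri _ idr] := Wedderburn_is_id_pchar F'G i.
apply/mxmoduleP=> g Gg; rewrite -gring_opG // -gring_opM; last first.
  exact: envelop_mx_id.
have /andP[_ idealR] := Wedderburn_ideal i.
have Rig : (e_ i *m regular_repr F G g \in Wedderburn_subring i)%MS.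
  apply: submx_trans idealR; apply: mem_mulsmx => //; exact: envelop_mx_id.
rewrite -(idr _ Rig) gring_opM ?submxMl //.
by rewrite (submx_trans Ri) // -(Wedderburn_sum_pchar sG F'G) (sumsmx_sup i).
Qed.

(** Let [e] be the central idempotent of the type of [U]. Its trace is its rank, so in
    characteristic 0 equal traces make [e] act as nonzero on [rG2] too. A simple submodule of the
    image of [e] is not killed by [e], hence has the type of [U]. *)
Lemma simple_constituent_of_trace n1 n2 (rG1 : mx_representation F G n1)
    (rG2 : mx_representation F G n2) U :
  {in G, forall g, \tr (rG1 g) = \tr (rG2 g)} ->
  forall simU : mxsimple rG1 U, exists U' (simU' : mxsimple rG2 U'),
    mx_rsim (submod_repr (mxsimple_module simU))
            (submod_repr (mxsimple_module simU')).
Proof.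
move=> eq_tr simU; have modU := mxsimple_module simU.
set rU := submod_repr _; have irrU : mx_irreducible rU by apply/submod_mx_irr.
pose i := irr_comp sG rU.
have [_ Ri _ idr] := Wedderburn_is_id_pchar F'G i.
have RGi : (e_ i \in group_ring F G)%MS.
  by rewrite (submx_trans Ri) // -(Wedderburn_sum_pchar sG F'G) (sumsmx_sup i).
have idE n (rG : mx_representation F G n) :
    gring_op rG (e_ i) *m gring_op rG (e_ i) = gring_op rG (e_ i).
  by rewrite -gring_opM // [_ *m _]idr.
have nzE2 : gring_op rG2 (e_ i) != 0.
  rewrite -mxrank_eq0; have/pcharf0P/(_ (\rank _)) <- := char0.
  rewrite -(mxtrace_idem (idE _ _)) -(mxtrace_gring_op eq_tr RGi).
  rewrite (mxtrace_idem (idE _ _)); have/pcharf0P-> := char0.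
  rewrite mxrank_eq0; apply/eqP=> E0; have [_ /negP nzU _] := simU; apply: nzU.
  have := gring_op_submod (mxsimple_module simU) RGi.
  rewrite -/rU (gring_op_irr_comp irrU) E0 mulmx0 mul1mx => S0.
  by rewrite -submx0 -(val_submod1 U) -S0 sub0mx.
have modE2 := gring_op_Wedderburn_module rG2 i.
have nz_genE2 : <<gring_op rG2 (e_ i)>>%MS != 0.
  by rewrite -mxrank_eq0 genmxE mxrank_eq0.
have modgE2 : mxmodule rG2 <<gring_op rG2 (e_ i)>>%MS.
  by rewrite (eqmx_module _ (genmxE _)).
have [U' simU' sU'E] := dec_mxsimple_exists modgE2 nz_genE2.
exists U', simU'; set rU' := submod_repr _.
have irrU' : mx_irreducible rU' by apply/submod_mx_irr.
suff eq_i : irr_comp sG rU' = i.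
  apply: mx_rsim_trans (rsim_irr_comp_pchar sG F'G irrU) (mx_rsim_sym _).
  by rewrite -[irr_comp sG rU]/i -eq_i; apply: rsim_irr_comp_pchar.
apply/eqP; apply/negPn/negP=> ne_i.
have := gring_op_submod (mxsimple_module simU') RGi.
rewrite eq_sym in ne_i.
rewrite -/rU' [gring_op rU' _](irr_comp'_op0_pchar F'G irrU' ne_i Ri) mul0mx.
have [X defS] : exists X, @val_submod F n2 U' _ 1%:M = X *m gring_op rG2 (e_ i).
  by apply/submxP; rewrite val_submod1 -(genmxE (gring_op rG2 _)).
rewrite defS -mulmxA idE => S0; have [_ /negP nzU' _] := simU'; apply: nzU'.
by rewrite -submx0 -(val_submod1 U') defS S0 sub0mx.
Qed.

(** Induction on the dimension: by Maschke's theorem a common simple constituent splits off on both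
    sides, and the complements still have equal traces. *)
Lemma mx_rsim_trace n1 n2 (rG1 : mx_representation F G n1)
    (rG2 : mx_representation F G n2) :
  {in G, forall g, \tr (rG1 g) = \tr (rG2 g)} -> mx_rsim rG1 rG2.
Proof.
elim/ltn_ind: n1 => n1 IHn in n2 rG1 rG2 *; move=> eq_tr.
have/pcharf0P eq0F := char0.
have [n1_0|nz_n1] := posnP n1.
  exists 0 => [||g _]; last by rewrite mulmx0 mul0mx.
    have := eq_tr 1%g (group1 G); rewrite !repr_mx1 !mxtrace1 n1_0 => /esym/eqP.
    by rewrite eq0F => /eqP->.
  by rewrite /row_free mxrank0 n1_0.
have nz1 : (1%:M : 'M[F]_n1) != 0 by rewrite -mxrank_eq0 mxrank1 -lt0n.
have [U simU _] := dec_mxsimple_exists (mxmodule1 rG1) nz1.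
have [U' [simU' rsimU]] := simple_constituent_of_trace eq_tr simU.
have [V modV defUV dxUV] :=
  mx_Maschke_pchar rG1 F'G (mxsimple_module simU) (submx1 U).
have [V' modV' defUV' dxUV'] :=
  mx_Maschke_pchar rG2 F'G (mxsimple_module simU') (submx1 U').
have rsimV : mx_rsim (submod_repr modV) (submod_repr modV').
  apply: IHn.
    rewrite -[ltnRHS](mxrank1 F) -defUV (mxdirectP dxUV) /= -[ltnLHS]add0n.
    by rewrite ltn_add2r lt0n mxrank_eq0; have [] := simU.
  move=> g Gg; apply: (addrI (\tr (submod_repr (mxsimple_module simU) g))).
  rewrite (mxtrace_dadd_mod _ _ (mxmodule1 rG1) defUV dxUV Gg).
  rewrite (mxtrace_rsim rsimU Gg).
  rewrite (mxtrace_dadd_mod _ _ (mxmodule1 rG2) defUV' dxUV' Gg).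
  by rewrite !(mxtrace_submod1 _ (eqmx_refl _)) ?eq_tr.
pose rU' := Representation (submod_repr (mxsimple_module simU')).
pose rV' := Representation (submod_repr modV').
have rsim1 : mx_rsim (submod_repr (mxmodule1 rG1)) (dadd_grepr rU' rV').
  exact: (@mx_rsim_dadd _ _ _ _ _ _ _ _ rU' rV' _ _ _ defUV dxUV rsimU rsimV).
have rsim2 : mx_rsim (submod_repr (mxmodule1 rG2)) (dadd_grepr rU' rV').
  exact: (@mx_rsim_dadd _ _ _ _ _ _ _ _ rU' rV' _ _ _ defUV' dxUV'
    (mx_rsim_refl _) (mx_rsim_refl _)).
apply: mx_rsim_trans (mx_rsim_sym (rsim_submod1 (mxmodule1 rG1) _)) _ => //.
apply: mx_rsim_trans (rsim_submod1 (mxmodule1 rG2) _) => //.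
exact: mx_rsim_trans rsim1 (mx_rsim_sym rsim2).
Qed.

End TraceDeterminesRepr.

(** * Traces on homology *)

Section SubquotientTraces.

Variables (F : fieldType) (gT : finGroupType) (G : {group gT}).
Variables (n : nat) (rG : mx_representation F G n).

(** A projection [P] onto [V] turns the trace on a submodule into a trace on the whole space, where
    different submodules can be compared. *)
Lemma mxtrace_submod_proj V (modV : mxmodule rG V) P g :
    g \in G -> (P <= V)%MS -> V *m P = V ->
  \tr (submod_repr modV g) = \tr (rG g *m P).
Proof.
move=> Gg sPV VP.
have hS : val_submod 1%:M *m rG g = submod_repr modV g *m val_submod 1%:M.
  by rewrite -[RHS]val_submodE -[submod_repr modV g]mul1mx val_submodJ.
have defP : P = in_submod V P *m val_submod 1%:M.
  by rewrite -val_submodE in_submodK.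
have SP : val_submod 1%:M *m P = @val_submod F n V _ 1%:M.
  have /submxP[X ->] : (@val_submod F n V _ 1%:M <= V)%MS by rewrite val_submod1.
  by rewrite -mulmxA VP.
have SP1 : val_submod 1%:M *m in_submod V P = 1%:M.
  by rewrite in_submodE mulmxA -in_submodE SP val_submodK.
rewrite [in RHS]defP mulmxA [RHS]mxtrace_mulC mulmxA.
by rewrite hS -mulmxA SP1 mulmx1.
Qed.

End SubquotientTraces.

(** [pU] projects onto [U] and [Q] lifts a projection onto [V] modulo [U]. Then [pU + Q] serves as
    projection onto [V], and its summands contribute the traces on [U] and on the section. *)
Lemma mxtrace_section (F : fieldType) (gT : finGroupType) (G : {group gT})
    n (rG : mx_representation F G n) U V
    (modU : mxmodule rG U) (modV : mxmodule rG V) g :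
    g \in G -> (U <= V)%MS ->
  \tr (section_repr modU modV g)
    = \tr (submod_repr modV g) - \tr (submod_repr modU g).
Proof.
move=> Gg sUV; set X := <<in_factmod U V>>%MS.
pose pU : 'M_n := in_submod U 1%:M *m val_submod 1%:M.
pose pX : 'M_(\rank (cokermx U)) := in_submod X 1%:M *m val_submod 1%:M.
pose Q : 'M_n := in_factmod U 1%:M *m pX *m val_factmod 1%:M.
have WQ m (W : 'M_(m, n)) : W *m Q = val_factmod (in_factmod U W *m pX).
  rewrite (in_factmodE U W) [RHS]val_factmodE /Q.
  by move: (in_factmod U 1%:M) (val_factmod 1%:M) => a b; rewrite !mulmxA.
have pXid m (W : 'M_(m, _)) : (W <= X)%MS -> W *m pX = W.
  by move=> sWX; rewrite /pX mulmxA -in_submodE -val_submodE in_submodK.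
have pUid m (W : 'M_(m, _)) : (W <= U)%MS -> W *m pU = W.
  by move=> sWU; rewrite /pU mulmxA -in_submodE -val_submodE in_submodK.
have spU : (pU <= U)%MS by rewrite /pU -val_submodE val_submodP.
have spX : (pX <= X)%MS by rewrite /pX -val_submodE val_submodP.
have sQV : (Q <= V)%MS.
  rewrite /Q -mulmxA mulmx_sub // -val_factmodE.
  have := in_factmodsK sUV => <-; apply: submx_trans (addsmxSr _ _).
  by rewrite val_factmodS -(genmxE (in_factmod U V)).
have VpQ : V *m (pU + Q) = V.
  rewrite mulmxDr -[RHS](add_sub_fact_mod U); congr (_ + _).
    by rewrite /pU mulmxA -in_submodE -val_submodE.
  by rewrite WQ pXid // genmxE.
rewrite (mxtrace_submod_proj modV Gg _ VpQ) ?addmx_sub ?(submx_trans spU) //.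
rewrite (mxtrace_submod_proj modU Gg spU (pUid _ _ (submx_refl _))).
rewrite mulmxDr mxtraceD addrC addKr.
have -> : \tr (section_repr modU modV g) = \tr (factmod_repr modU g *m pX).
  by apply: mxtrace_submod_proj; rewrite ?pXid.
have -> : factmod_repr modU g = val_factmod 1%:M *m in_factmod U (rG g).
  rewrite [in RHS]in_factmodE [RHS]mulmxA -[RHS]in_factmodE; exact: erefl.
rewrite WQ [val_factmod (_ *m pX)]val_factmodE [RHS]mxtrace_mulC.
by move: (val_factmod 1%:M) (in_factmod U (rG g)) => a b; rewrite -(mulmxA a).
Qed.

Section EulerTrace.

Variables (F : fieldType) (gT : finGroupType) (d : Order.disp_t).
Variables (T : finPOrderType d) (to : {action gT &-> T}).
Hypothesis to_homo : forall g, {homo to^~ g : x y / (x < y)%O}.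

Local Notation chain_repr := (chain_repr F to_homo).
Local Notation Z m := (submod_repr (cycles_module F to_homo m)).
Local Notation B m := (submod_repr (boundaries_module F to_homo m)).

Lemma mxtrace_homology m g :
  \tr (homology_repr F to_homo m g) = \tr (Z m g) - \tr (B m g).
Proof. by rewrite mxtrace_section ?inE ?boundaries_sub_cycles. Qed.

Lemma mxtrace_cycles0 g : \tr (Z 0 g) = \tr (chain_repr 0 g).
Proof.
by rewrite (mxtrace_submod_proj _ _ (submx1 1%:M)) ?inE ?mulmx1.
Qed.

(** For a generalized inverse [f'] of [f], [1 - f f'] projects onto the cycles and [f' f] onto the
    boundaries; the extra traces cancel because [f] commutes with the action. *)
Lemma mxtrace_rank_nullity m g :
  \tr (Z m.+1 g) + \tr (B m g) = \tr (chain_repr m.+1 g).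
Proof.
set f := boundary_mx F T m.
have [f' ff'f] : exists f', f *m f' *m f = f.
  by exists (pinvmx f); rewrite mulmxKpV.
rewrite (@mxtrace_submod_proj _ _ _ _ _ _ _ (1%:M - f *m f')) ?inE //; first last.
- by rewrite mulmxBr mulmx1 mulmxA mulmx_ker mul0mx subr0.
- by apply/sub_kermxP; rewrite mulmxBl mul1mx ff'f subrr.
rewrite (@mxtrace_submod_proj _ _ _ _ _ _ _ (f' *m f)) ?inE //; first last.
- have /submxP[X ->] : (boundaries F T m <= f)%MS by rewrite genmxE.
  by rewrite -!mulmxA (mulmxA f) ff'f.
- by rewrite genmxE submxMl.
rewrite mulmxBr mulmx1 linearB /= -[RHS]addr0 -addrA; congr (_ + _).
apply/eqP; rewrite addrC subr_eq0; apply/eqP.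
by rewrite mulmxA mxtrace_mulC !mulmxA boundary_mxJ.
Qed.

(** The Hopf trace formula: rank-nullity telescopes, since cycles and boundaries agree below [N] and
    there are no chains above [N]. *)
Lemma mxtrace_homology_concentrated N g :
    (forall m, (m < N)%N -> (cycles F T m <= boundaries F T m)%MS) ->
    (forall m, (N < m)%N -> #|{: chain T m}| = 0%N) ->
  forall m, \tr (homology_repr F to_homo m g)
    = if m == N then \sum_(j < N.+1) (-1) ^+ (N - j) * \tr (chain_repr j g)
      else 0.
Proof.
move=> acyclic no_chain m; rewrite mxtrace_homology.
have eq_small j : (j < N)%N -> \tr (Z j g) = \tr (B j g).
  move=> lt_jN; have [P [sPB BP]] : exists P, (P <= boundaries F T j)%MS
      /\ boundaries F T j *m P = boundaries F T j.
    exists (pinvmx (boundaries F T j) *m boundaries F T j).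
    by rewrite submxMl mulmxA mulmxKpV.
  rewrite (mxtrace_submod_proj _ _ _ BP) ?inE //.
  rewrite (@mxtrace_submod_proj _ _ _ _ _ _ _ P) ?inE //.
    exact: submx_trans (boundaries_sub_cycles _ _ _).
  by have /submxP[X ->] := acyclic j lt_jN; rewrite -mulmxA BP.
have tr0 j : (N < j)%N -> \tr (chain_repr j g) = 0.
  move=> /no_chain c0; rewrite /mxtrace big1 // => i.
  by move: (ltn_ord i); rewrite {2}c0.
have B0 j : (N <= j)%N -> \tr (B j g) = 0.
  move=> le_Nj; rewrite (@mxtrace_submod_proj _ _ _ _ _ _ _ 0);
    rewrite ?inE ?mulmx0 ?mxtrace0 ?sub0mx //.
  apply/esym/eqP; rewrite -submx0 genmxE.
  by apply/row_subP=> i; move: (ltn_ord i); rewrite {2}no_chain.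
have Zsum j : (j <= N)%N ->
    \tr (Z j g) = \sum_(i < j.+1) (-1) ^+ (j - i) * \tr (chain_repr i g).
  elim: j => [|j IHj] lt_j.
    by rewrite big_ord_recl big_ord0 addr0 mul1r mxtrace_cycles0.
  rewrite big_ord_recr /= subnn mul1r -mxtrace_rank_nullity addrC -[LHS]addr0.
  rewrite -addrA; congr (_ + _); rewrite -eq_small // IHj ?(ltnW lt_j) //.
  apply/esym/eqP; rewrite addr_eq0 -sumrN; apply/eqP.
  apply: eq_bigr => i _; have le_ij : (i <= j)%N by rewrite -ltnS.
  by rewrite (subSn le_ij) exprS mulN1r mulNr opprK.
case: (ltngtP m N) => [lt_mN|lt_Nm|->].
- by rewrite eq_small ?subrr.
- rewrite B0 ?subr0 ?(ltnW lt_Nm) //; case: m lt_Nm => // m lt_Nm.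
  by have := mxtrace_rank_nullity m g; rewrite tr0 // B0 // addr0.
by rewrite B0 // subr0 Zsum.
Qed.

End EulerTrace.

(** * Acyclicity *)

Section Acyclicity.

Variables (F : fieldType) (d : Order.disp_t) (T : finPOrderType d).

Lemma perm_delete x l (s : seq T) :
  (l < size s)%N -> perm_eq (nth x s l :: delete l s) s.
Proof.
move=> lt_l; rewrite -[X in perm_eq _ X](cat_take_drop l) (drop_nth x) //.
by rewrite /delete perm_sym perm_catC /= perm_cons perm_catC.
Qed.

Lemma boundary_mx_neq0 m i j :
  boundary_mx F T m i j != 0 -> subseq (val (enum_val j)) (val (enum_val i)).
Proof.
rewrite mxE => nz; have [/existsP[l /eqP<-]|] := boolP [exists l : 'I_m.+1,
    delete l (val (enum_val i)) == val (enum_val j) :> seq T].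
  exact: subseq_del.
rewrite negb_exists => /forallP none; case/eqP: nz.
by rewrite big1 // => l _; rewrite (negbTE (none l)) mulr0.
Qed.

(** The vertices of a chain are distinct, so only the omission of [x] gives [c], and the coefficient
    is a single sign. *)
Lemma boundary_mx_facet m x (c' : chain T m.+1) (c : chain T m) :
    perm_eq (val c') (x :: val c) ->
  boundary_mx F T m (enum_rank c') (enum_rank c) != 0.
Proof.
move=> perm_c; have ux : uniq (x :: val c).
  by rewrite -(perm_uniq perm_c) (lt_sorted_uniq (valP c')).
have uc' : uniq (val c') by rewrite (perm_uniq perm_c).
have xc' : x \in (val c' : seq T) by rewrite (perm_mem perm_c) mem_head.
have lt_x : (index x (val c') < m.+1)%N.
  by rewrite -[ltnRHS](size_tuple (val c')) index_mem.
rewrite mxE !enum_rankK (bigD1 (Ordinal lt_x)) //= big1 ?addr0 => [|l ne_l].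
  rewrite (_ : delete _ _ = val c) ?eqxx ?mulr1 ?signr_eq0 //.
  apply: lt_sorted_eq (valP c) _; first exact: sorted_delete (valP c').
  apply: perm_mem; rewrite -(perm_cons x) -(permPr perm_c).
  by rewrite -{1}(nth_index x xc') perm_delete // size_tuple.
case: eqP => [def_c|]; last by rewrite mulr0.
case/eqP: ne_l; apply: val_inj => /=.
have lt_l : (l < size (val c'))%N by rewrite size_tuple.
have := perm_mem (perm_delete x lt_l) x; rewrite xc' inE def_c.
have /andP[/negbTE-> _] := ux; rewrite orbF => /eqP->.
by rewrite index_uniq.
Qed.

Variables (d' : Order.disp_t) (W : orderType d').
(* The chains s with a given value of phi are matched by inserting or removing
   the vertex v (phi s). *)
Variables (phi : seq T -> W) (v : W -> T) (N : nat).
Hypothesis phi_mono :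
  forall s s' : seq T, sorted <%O s' -> subseq s s' -> (phi s <= phi s')%O.
Hypothesis phi_add : forall s : seq T,
  sorted <%O s -> (size s < N)%N -> v (phi s) \notin s ->
  exists s', [/\ sorted <%O s', perm_eq s' (v (phi s) :: s) & phi s' = phi s].
Hypothesis phi_rem : forall s : seq T,
  sorted <%O s -> (size s < N)%N -> v (phi s) \in s ->
  phi (filter (predC1 (v (phi s))) s) = phi s.

Let apex m (c : chain T m) := v (phi (val c)).
Let apex_free m := [set c : chain T m | apex c \notin (val c : seq T)].

(* Ordered by phi, the boundaries of the extensions by the apex are triangular
   with entries +-1 on the diagonal. *)
Lemma card_apex_free_leq_rank m :
  (m < N)%N -> (#|apex_free m| <= \rank (boundary_mx F T m))%N.
Proof.
move=> lt_mN; pose c (i : 'I_#|apex_free m|) : chain T m := enum_val i.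
have ext i : exists c' : chain T m.+1,
    perm_eq (val c') (apex (c i) :: val (c i)) /\ phi (val c') = phi (val (c i)).
  have := enum_valP i; rewrite inE => apex_c.
  have sz : size (val (c i)) = m by rewrite size_tuple.
  have [|s' [s'_sorted perm_s' phi_s']] := phi_add (valP (c i)) _ apex_c.
    by rewrite sz.
  have sz' : size s' == m.+1 by rewrite (perm_size perm_s') /= sz.
  by exists (Sub (Tuple sz') s'_sorted).
have [g gP] := fin_all_exists ext.
pose X := rowsub (fun i => enum_rank (g i)) (boundary_mx F T m).
have sX : (X <= boundary_mx F T m)%MS.
  by apply/row_subP=> i; rewrite row_rowsub row_sub.
suff freeX : row_free X by rewrite -(eqP freeX) mxrankS.
rewrite -kermx_eq0; apply/rowV0P=> u /sub_kermxP uX0.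
apply/eqP; apply: contraT => /rV0Pn[i0 nz_i0].
(* In a relation [u] among the rows, take a nonzero coefficient with [phi] maximal and look at the
   column of its chain [c i]. *)
case: (@arg_maxP _ _ _ i0 (fun i => u 0 i != 0) (fun i => phi (val (c i))) nz_i0).
move=> i nz_i max_i.
have := congr1 (fun M : 'rV_ _ => M 0 (enum_rank (c i))) uX0.
rewrite !mxE (bigD1 i) //= big1 => [/eqP|j ne_ji].
  rewrite addr0 mulf_eq0 (negbTE nz_i) /= !mxE => /eqP e0.
  by have := boundary_mx_facet (gP i).1; rewrite mxE e0 eqxx.
(* If row [j] met this column, [c i] would be a facet of the extension of [c j], so [phi] would
   agree on both by maximality; avoiding the common apex, [c i] would be [c j]. *)
apply/eqP; rewrite mulf_eq0; apply: contraT; rewrite negb_or => /andP[nz_j].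
rewrite [X in X != 0]mxE => /boundary_mx_neq0; rewrite !enum_rankK => sub_ij.
have := phi_mono (valP (g j)) sub_ij; rewrite (gP j).2 => le_ij.
have eq_phi : phi (val (c i)) = phi (val (c j)).
  by apply/le_anti/andP; split; [|apply: max_i].
case/eqP: ne_ji; apply/esym/enum_val_inj/val_inj/val_inj.
have := enum_valP i; rewrite inE => apex_ci.
apply: lt_sorted_eq (valP (c i)) (valP (c j)) _.
have cij : {subset val (c i) <= val (c j)}.
  move=> x xi; have := mem_subseq sub_ij xi; rewrite (perm_mem (gP j).1) inE.
  case/predU1P=> // def_x; case/negP: apex_ci.
  by rewrite /apex eq_phi -[v _]/(apex (c j)) -def_x.
have uci := lt_sorted_uniq (valP (c i)).
by have [|] := uniq_min_size uci cij; first rewrite !size_tuple.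
Qed.

(** Dropping the apex from a chain that contains it changes neither [phi] nor the apex, so it is an
    injection into the apex-free chains. *)
Lemma card_chain_leq_apex_free m : (m.+1 < N)%N ->
  (#|{: chain T m.+1}| <= #|apex_free m.+1| + #|apex_free m|)%N.
Proof.
move=> lt_mN; rewrite -(cardsC (apex_free m.+1)) leq_add2l.
pose c (i : 'I_#|~: apex_free m.+1|) : chain T m.+1 := enum_val i.
have red i : exists c' : chain T m, c' \in apex_free m /\
    val (val c') = filter (predC1 (apex (c i))) (val (c i)).
  have := enum_valP i; rewrite !inE negbK => apex_c.
  have lt_s : (size (val (c i)) < N)%N by rewrite size_tuple.
  set s := filter _ _.
  have s_sorted : sorted <%O s by apply: lt_sorted_filter (valP (c i)).
  have sz : size s == m.
    rewrite -eqSS -[X in _ == X](size_tuple (val (c i))) size_filter.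
    rewrite -(count_predC (pred1 (apex (c i)))) addnC.
    rewrite -[count (pred1 _) _]/(count_mem _ _).
    by rewrite count_uniq_mem ?apex_c ?addn1 ?(lt_sorted_uniq (valP (c i))).
  exists (Sub (Tuple sz) s_sorted); split=> //; rewrite inE /apex /=.
  by rewrite /s phi_rem ?(valP (c i)) // mem_filter /= eqxx.
have [g gP] := fin_all_exists red.
rewrite -[leqLHS]card_ord -(card_imset (f := g)) => [|i j eq_g].
  by apply: subset_leq_card; apply/subsetP=> _ /imsetP[i _ ->]; have [] := gP i.
have phi_g k : phi (val (g k)) = phi (val (c k)).
  have := enum_valP k; rewrite !inE negbK => apex_c.
  by rewrite (gP k).2 phi_rem ?(valP (c k)) ?size_tuple.
have eq_apex : apex (c i) = apex (c j) by rewrite /apex -!phi_g eq_g.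
apply/enum_val_inj/val_inj/val_inj.
apply: lt_sorted_eq (valP (c i)) (valP (c j)) _ => x.
have := enum_valP i; rewrite !inE negbK => apex_ci.
have := enum_valP j; rewrite !inE negbK => apex_cj.
have [->|ne_x] := eqVneq x (apex (c i)); first by rewrite apex_ci eq_apex apex_cj.
have := mem_filter (predC1 (apex (c i))) x (val (c i)).
rewrite -(gP i).2 eq_g (gP j).2 mem_filter /= -eq_apex ne_x /=.
by move=> ->.
Qed.

(** A dimension count: cycles have dimension the number of chains minus a rank, which is at most the
    number of apex-free chains, hence at most the dimension of the boundaries. *)
Lemma acyclic_below m : (m < N)%N -> (cycles F T m <= boundaries F T m)%MS.
Proof.
move=> lt_mN; have := mxrank_leqif_sup (boundaries_sub_cycles F T m).
move=> /geq_leqif <-; rewrite [leqRHS]genmxE.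
apply: leq_trans (card_apex_free_leq_rank lt_mN).
case: m lt_mN => [_|m lt_mN] /=.
  rewrite mxrank1 -cardsT subset_leq_card //; apply/subsetP=> c _.
  by rewrite inE (tuple0 (val c)).
rewrite mxrank_ker leq_subLR addnC.
apply: leq_trans (card_chain_leq_apex_free lt_mN) _.
by rewrite leq_add2l card_apex_free_leq_rank // ltnW.
Qed.

End Acyclicity.

(** * Lexicographic shelling of the word poset *)

Section WordsAcyclic.

Variables (F : fieldType) (A : finType) (k : nat) (S : pred nat).
Hypothesis A_gt1 : (1 < #|A|)%N.
Hypothesis S_bound : forall j, S j -> (1 <= j <= k)%N.
Local Notation T := (words A k S).

Let word (w : T) : seq A := val (val w).
Let w0 : seq A := flatten (nseq k (enum A)).

(** The successive letters of [w] are found in successive copies of the alphabet. *)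
Lemma subseq_universal (w : seq A) : (size w <= k)%N -> subseq w w0.
Proof.
rewrite /w0; elim: k w => [|j IHj] [|a w] //= le_w; first exact: sub0seq.
rewrite -[a :: w]/([:: a] ++ w) cat_subseq ?IHj // sub1seq.
exact: mem_enum.
Qed.

Lemma size_universal : size w0 = (k * #|A|)%N.
Proof. by rewrite size_flatten /shape map_nseq sumn_nseq mulnC -cardE. Qed.

Lemma size_word_bound (w : T) : (1 <= size (word w) <= k)%N.
Proof. exact: S_bound (valP w). Qed.

Lemma word_lt_universal (w : T) : subseq (word w) w0 && (size (word w) < size w0)%N.
Proof.
have /andP[w_gt0 le_wk] := size_word_bound w.
rewrite subseq_universal //= size_universal; nia.
Qed.

Lemma words_leE (u w : T) : (u <= w)%O = subseq (word u) (word w).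
Proof. by []. Qed.

Lemma map_word_sorted (s : seq T) : sorted <%O s -> sorted subseq (map word s).
Proof. by rewrite sorted_map; apply: sub_sorted => u w; apply: ltW. Qed.

Let n := size w0.
Let phi (s : seq T) : seqlexi nat := labels (next_target (map word s)) n w0.
(** Path and ascents are read off from the labels [F] alone, as the apex may depend on a chain only
    through [phi]. *)
Let path (F : seq nat) i := foldl (fun y p => del p y) w0 (take i F).
Let ascent (F : seq nat) (w : T) :=
  has (fun i => (word w == path F i.+1) &&
                (greedy_pos (path F i) (path F i.+2) == nth 0%N F i)) (iota 0 n.-1).

Section Chain.

Variable s : seq T.
Hypothesis s_sorted : sorted <%O s.
Let G := map word s.
Let X i := iter i (greedy_step (next_target G)) w0.

Let G_sorted : sorted subseq G.
Proof. by exact: map_word_sorted. Qed.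

Let G_sub g : g \in G -> subseq g w0 && (size g < size w0)%N.
Proof. by case/mapP=> w _ ->; apply: word_lt_universal. Qed.

Let size_X i : (i <= n)%N -> size (X i) = (n - i)%N.
Proof. exact: size_greedy_path. Qed.

Lemma path_phi i : (i <= n)%N -> path (phi s) i = X i.
Proof. exact: foldl_labels. Qed.

Lemma ascentP w : reflect (exists i, [/\ (i.+1 < n)%N, word w = X i.+1
    & greedy_pos (X i) (X i.+2) = greedy_pos (X i) (next_target G (size (X i)))])
  (ascent (phi s) w).
Proof.
apply: (iffP hasP) => [] [ i ].
  rewrite mem_iota => /andP[_ lt_i] /andP[/eqP def_w /eqP asc].
  have lt_in : (i.+1 < n)%N by lia.
  have lt_in' : (i < n)%N by lia.
  rewrite (path_phi (ltnW lt_in)) in def_w.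
  rewrite (path_phi (ltnW lt_in')) (path_phi lt_in) (nth_labels _ _ lt_in') in asc.
  by exists i.
case=> lt_in def_w asc; have lt_in' : (i < n)%N by lia.
exists i; first by rewrite mem_iota; lia.
rewrite (path_phi (ltnW lt_in)) (path_phi (ltnW lt_in')) (path_phi lt_in).
by rewrite (nth_labels _ _ lt_in') -def_w asc !eqxx.
Qed.

(** As [s] and [s'] differ only in ascents, [s'] lies on the greedy path of [s] and contains all its
    descents. *)
Lemma phi_ext s' :
    sorted <%O s' -> (forall w, w \in s' -> (w \in s) || ascent (phi s) w) ->
    (forall w, w \in s -> (w \in s') || ascent (phi s) w) ->
  phi s' = phi s.
Proof.
move=> s'_sorted s's ss'; apply: (labels_eq_path G_sorted G_sub).
- by exact: map_word_sorted.
- move=> _ /mapP[w s'w ->]; have /andP[_ lt_w] := word_lt_universal w.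
  split; first exact: ltnW.
  have /orP[sw|/ascentP[i [lt_i def_w _]]] := s's w s'w.
    by apply: (greedy_path_mem G_sorted G_sub); apply: map_f.
  have sz_i : size (X i.+1) = (n - i.+1)%N by apply: size_X; apply: ltnW.
  by rewrite def_w sz_i (subKn (ltnW lt_i)).
move=> i lt_i s'X; have [|GX] := boolP (X i.+1 \in G); last first.
  exact: (greedy_path_ascent G_sorted G_sub).
case/mapP=> w sw def_w; have /orP[s'w|/ascentP[j [lt_j def_w' asc]]] := ss' w sw.
  by case/negP: s'X; rewrite [X in X \in _]def_w map_f.
suff -> : i = j by [].
have sz_i : size (X i.+1) = (n - i.+1)%N by apply: size_X; apply: ltnW.
have sz_j : size (X j.+1) = (n - j.+1)%N by apply: size_X; apply: ltnW.
by move: sz_i; rewrite def_w def_w' sz_j; lia.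
Qed.

(** A chain with too few words misses a length in [S]; the path word of that length is outside the
    chain, hence an ascent. *)
Lemma exists_ascent : (size s < count S (iota 1 k))%N -> exists w, ascent (phi s) w.
Proof.
pose ranks := map (fun w => size (word w)) s.
move=> lt_s; have [/allP all_rank|] := boolP (all [in ranks] (filter S (iota 1 k))).
  have := uniq_leq_size (filter_uniq _ (iota_uniq 1 k)) all_rank.
  by rewrite size_filter size_map leqNgt lt_s.
case/allPn=> l; rewrite mem_filter mem_iota => /andP[Sl /andP[l_gt0 _]] no_l.
have /andP[_ le_lk] := S_bound Sl.
have lt_ln : (l < n)%N by rewrite /n size_universal; nia.
have [i def_l] : exists i, (n - l)%N = i.+1 by exists (n - l).-1; lia.
have lt_i : (i.+1 < n)%N by lia.
have sz_X : size (X i.+1) = l.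
  by rewrite (size_X (ltnW lt_i)) -def_l subKn // ltnW.
have le_X : (size (X i.+1) <= k)%N by rewrite sz_X.
have SX : S (size (Bseq le_X)) by rewrite -[size _]/(size (X i.+1)) sz_X.
exists (Sub (Bseq le_X) SX : T); apply/ascentP; exists i; split=> //.
apply: (greedy_path_ascent G_sorted G_sub lt_i).
apply/negP=> /mapP[w sw def_w]; case/negP: no_l; apply/mapP; exists w => //.
by rewrite -def_w.
Qed.

(** Both words lie on the greedy path of [s]; hence an ascent can be inserted into [s]. *)
Lemma ascent_comparable w w' : (w \in s) || ascent (phi s) w ->
  (w' \in s) || ascent (phi s) w' -> (w <= w')%O || (w' <= w)%O.
Proof.
have on_path u : (u \in s) || ascent (phi s) u ->
    exists2 i, (i <= n)%N & word u = X i.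
  case/orP=> [su|/ascentP[i [lt_i -> _]]]; last by exists i.+1; rewrite // ltnW.
  exists (n - size (word u))%N; first exact: leq_subr.
  by apply: (greedy_path_mem G_sorted G_sub); apply: map_f.
move=> /on_path[i le_i def_w] /on_path[j le_j def_w'].
rewrite !words_leE def_w def_w'; have [le_ij|/ltnW le_ji] := leqP i j.
  by rewrite orbC greedy_path_subseq ?le_ij.
by rewrite greedy_path_subseq ?le_ji.
Qed.

End Chain.

Lemma words_acyclic m : (m < count S (iota 1 k))%N ->
  (cycles F T m <= boundaries F T m)%MS.
Proof.
(* The empty chain supplies a word [x0], the default of [v] on label sequences without ascents. *)
move=> lt_m; have [|x0 _] := @exists_ascent [::] isT; first exact: leq_trans lt_m.
pose v (L : seq nat) : T := odflt x0 [pick w | ascent L w].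
have vP (s : seq T) : sorted <%O s -> (size s < count S (iota 1 k))%N ->
    ascent (phi s) (v (phi s)).
  move=> s_sorted /(exists_ascent s_sorted)[w w_asc].
  by rewrite /v; case: pickP => //= /(_ w); rewrite w_asc.
apply: (@acyclic_below F _ T _ (seqlexi nat) phi v) lt_m.
- move=> s s' s'_sorted sub_s; apply: labels_le => l; apply: next_target_mono.
    by apply: mem_subseq; apply: map_subseq.
  by exact: map_word_sorted.
- move=> s s_sorted lt_s v_s; have v_asc := vP s s_sorted lt_s.
  pose P := [pred w | (w \in s) || ascent (phi s) w].
  have P_vs : all P (v (phi s) :: s).
    rewrite /= v_asc orbT; apply/allP=> w sw; by rewrite /= sw.
  have perm_s' : perm_eq (sort <=%O (v (phi s) :: s)) (v (phi s) :: s).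
    by rewrite perm_sort.
  have s'_sorted : sorted <%O (sort <=%O (v (phi s) :: s)).
    rewrite lt_sorted_uniq_le sort_uniq /= v_s lt_sorted_uniq //=.
    apply: (sort_sorted_in _ P_vs) => w w'; exact: ascent_comparable.
  exists (sort <=%O (v (phi s) :: s)); split=> //.
  apply: phi_ext => // w; rewrite mem_sort inE.
    by case/predU1P=> ->; rewrite ?v_asc ?orbT.
  by move=> ->; rewrite orbT.
move=> s s_sorted lt_s v_s; have v_asc := vP s s_sorted lt_s.
apply: phi_ext => // [|w|w].
- exact: lt_sorted_filter.
- by rewrite mem_filter => /andP[_ ->].
by rewrite mem_filter /=; case: eqP => //= [->|_ ->]; rewrite ?v_asc ?orbT.
Qed.

End WordsAcyclic.

(** * Counting chains *)

Section SuperwordCounts.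

Variables (R : comNzRingType) (b : R).

(* The number of words of length j on b letters that contain a given word of
   length i: compare the first letters. *)
Fixpoint superwords (i j : nat) : R :=
  if j is j'.+1
  then if i is i'.+1 then superwords i' j' + (b - 1) * superwords i j' else b ^+ j
  else (i == 0%N)%:R.

Lemma superwords0 j : superwords 0 j = b ^+ j.
Proof. by case: j. Qed.

Lemma superwordsS i j :
  superwords i.+1 j.+1 = superwords i j + (b - 1) * superwords i.+1 j.
Proof. by []. Qed.

Lemma superwords_gt i j : (j < i)%N -> superwords i j = 0.
Proof.
elim: j i => [|j IHj] [|i] //= lt_ji.
by rewrite !IHj ?mulr0 ?addr0 // ltnW.
Qed.

Lemma superwords_diag i : superwords i i = 1.
Proof. by elim: i => //= i ->; rewrite superwords_gt // mulr0 addr0. Qed.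

(* Minus the row of index 0 of the inverse of the matrix superwords. *)
Definition inv_row0 i : R := if i is i'.+1 then b * (1 - b) ^+ i' else -1.

(** At a positive index [j.+1], the recurrence of [superwords] makes [- b ^+ j.+1] cancel against
    [b * b ^+ j], and [(1 - b) Q] against [(b - 1) Q]. *)
Lemma inv_row0_superwords n j : (j < n)%N ->
  \sum_(i < n) inv_row0 i * superwords i j = - (j == 0%N)%:R.
Proof.
case: n => // n; rewrite ltnS => le_jn; rewrite big_ord_recl superwords0 /=.
case: j le_jn => [|j] le_jn.
  by rewrite big1 ?addr0 ?mulr1 // => i _; rewrite mulr0.
case: n le_jn => // n; rewrite ltnS => le_jn.
pose Q := \sum_(i < n) inv_row0 i.+1 * superwords i.+1 j.
have -> : \sum_(i < n.+1) inv_row0 (lift ord0 i) * superwords (lift ord0 i) j.+1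
    = \sum_(i < n.+1) inv_row0 i.+1 * superwords i j
      + (b - 1) * \sum_(i < n.+1) inv_row0 i.+1 * superwords i.+1 j.
  rewrite mulr_sumr -big_split; apply: eq_bigr => i _.
  by rewrite lift0 superwordsS /=; ring.
have -> : \sum_(i < n.+1) inv_row0 i.+1 * superwords i.+1 j = Q.
  by rewrite big_ord_recr /= [superwords n.+1 j]superwords_gt // mulr0 addr0.
rewrite big_ord_recl superwords0.
have -> : \sum_(i < n) inv_row0 (lift ord0 i).+1 * superwords (lift ord0 i) j
    = (1 - b) * Q.
  by rewrite mulr_sumr; apply: eq_bigr => i _; rewrite lift0 /= exprS; ring.
by rewrite /= exprS; ring.
Qed.

(* Signed number of chains of words of length at most k strictly above a word of
   length j. *)
Definition unit_sol k j : R := (1 - b) ^+ (k - j) * 'C(k, j)%:R.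

(** For [i = 0] this is the binomial theorem for [1 = (1 - b) + b]; otherwise Pascal's rule meets
    the recurrence of [superwords]. *)
Lemma superwords_unit_sol k i : (i <= k)%N ->
  \sum_(j < k.+1) superwords i j * unit_sol k j = 1.
Proof.
elim: k i => [|k IHk] [|i] //= le_ik.
- by rewrite big_ord_recl big_ord0 /unit_sol /= !mulr1 addr0.
- rewrite -[RHS](expr1n _ k.+1) -[in RHS](subrK b 1) exprDn.
  apply: eq_bigr => j _; rewrite superwords0 /unit_sol mulrCA mulrA mulrC.
  by rewrite -mulr_natr; ring.
pose P := \sum_(j < k.+1) superwords i.+1 j * unit_sol k j.
(* The shift drops a first term with [superwords i.+1 0 = 0] and adds a last one with
   ['C(k, k.+1) = 0]. *)
have defP : P = \sum_(j < k.+1)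
    superwords i.+1 j.+1 * ((1 - b) ^+ (k - j.+1) * 'C(k, j.+1)%:R).
  rewrite [RHS]big_ord_recr /= (bin_small (ltnSn k)) !mulr0 addr0.
  by rewrite /P big_ord_recl /= mul0r add0r.
rewrite big_ord_recl /= mul0r add0r.
transitivity ((1 - b) * P
  + (\sum_(j < k.+1) superwords i j * unit_sol k j + (b - 1) * P)).
  rewrite {1}defP /P !mulr_sumr -!big_split /=; apply: eq_bigr => j _.
  rewrite /unit_sol /bump /= ?add1n ?add0n binS natrD subSS.
  have [le_jk|lt_kj] := leqP j.+1 k; last first.
    by rewrite [X in X%:R]bin_small // /=; ring.
  by rewrite -(subnSK le_jk) exprS /=; ring.
by rewrite IHk //; ring.
Qed.

(** From rank [r] upwards [X] is the solution [unit_sol] for all ranks. With its entry at [r] set to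
    0, [superwords] sends it to the all-one vector minus [unit_sol k r] at position [r]; row 0 of
    the inverse then yields [X 0]. *)
Lemma deleted_rank_sum k r (X : nat -> R) : (0 < r < k)%N ->
    (forall i, X i
      + \sum_(j < k.+1 | [&& (1 <= j <= k)%N, (j : nat) != r & (i < j)%N])
        superwords i j * X j = 1) ->
  X 0 = b * (1 - b) ^+ k.-1 * 'C(k, r)%:R - \sum_(i < k.+1) inv_row0 i.
Proof.
move=> /andP[r_gt0 lt_rk] eqX.
have sum_gt i (Y : nat -> R) : (i <= k)%N ->
    \sum_(j < k.+1) superwords i j * Y j
      = Y i + \sum_(j < k.+1 | (i < j)%N) superwords i j * Y j.
  move=> le_ik; have lt_i : (i < k.+1)%N by [].
  rewrite (bigD1 (Ordinal lt_i)) //= superwords_diag mul1r; congr (_ + _).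
  rewrite big_mkcond [RHS]big_mkcond; apply: eq_bigr => j _ /=.
  by rewrite -val_eqE /=; case: ltngtP => //= lt_ji; rewrite superwords_gt ?mul0r.
(* All ranks above such an [i] are kept, so induction downwards from [k] applies. *)
have X_gam i : (r <= i <= k)%N -> X i = unit_sol k i.
  have [m] := ubnP (k - i)%N; elim: m i => // m IHm i lt_m /andP[le_ri le_ik].
  apply: (addIr (\sum_(j < k.+1 | (i < j)%N) superwords i j * unit_sol k j)).
  rewrite -sum_gt // superwords_unit_sol // -(eqX i); congr (_ + _).
  apply: eq_big => j; first by have := ltn_ord j; lia.
  by move=> lt_ij; rewrite IHm //; have := ltn_ord j; lia.
pose X' j := if j == r then 0 else X j.
have eqX' i : (i < k.+1)%N ->
    \sum_(j < k.+1) superwords i j * X' j = 1 - (i == r)%:R * unit_sol k r.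
  rewrite ltnS => le_ik; rewrite sum_gt // -[X in X - _](eqX i).
  have -> : \sum_(j < k.+1 | (i < j)%N) superwords i j * X' j = \sum_(j < k.+1 |
      [&& (1 <= j <= k)%N, (j : nat) != r & (i < j)%N]) superwords i j * X j.
    rewrite big_mkcond [RHS]big_mkcond; apply: eq_bigr => j _; rewrite /X'.
    have le_jk : (j <= k)%N by rewrite -ltnS.
    rewrite le_jk andbT; case: (ltnP i j) => lt_ij; last by rewrite !andbF.
    by rewrite (leq_ltn_trans _ lt_ij) //=; case: eqP; rewrite ?mulr0.
  rewrite {1}/X'; have [->|_] := eqVneq i r; last by rewrite mul0r subr0.
  by rewrite X_gam ?leqnn ?(ltnW lt_rk) //= mul1r; ring.
have : \sum_(i < k.+1) inv_row0 i * (\sum_(j < k.+1) superwords i j * X' j)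
    = - X 0%N.
  under eq_bigr do rewrite mulr_sumr.
  rewrite exchange_big /= big_ord_recl [X in _ + X]big1 ?addr0 => [|j _].
    under eq_bigr do rewrite mulrA.
    by rewrite -mulr_suml inv_row0_superwords // mulN1r /X' /= ltn_eqF.
  under eq_bigr do rewrite mulrA.
  by rewrite -mulr_suml inv_row0_superwords // lift0 oppr0 mul0r.
have lt_r : (r < k.+1)%N by apply: ltnW.
under eq_bigr => i _ do rewrite eqX' // mulrBr mulr1.
rewrite sumrB [X in _ - X](bigD1 (Ordinal lt_r)) //= eqxx mul1r.
rewrite [X in _ - (_ + X)]big1 ?addr0 => [|i]; last first.
  by rewrite -val_eqE /= => /negbTE->; rewrite mul0r mulr0.
move=> /(congr1 -%R); rewrite opprK => <-; rewrite opprB /unit_sol; congr (_ - _).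
case: r r_gt0 lt_rk {eqX X_gam X' eqX' lt_r} => // r _ lt_rk /=.
(* The removed rank is now [r.+1]. The exponents [r] of [inv_row0] and [k - r.+1] of [unit_sol] add
   up to [k - 1] whatever [r] is, which leaves only the binomial coefficient. *)
have -> : k.-1 = (r + (k - r.+1))%N by lia.
by rewrite exprD; ring.
Qed.

End SuperwordCounts.

(** * Chains of words over a subset of the letters *)

Section ChainCounts.

Variables (R : comNzRingType) (A : finType) (k : nat) (S : pred nat).
Hypothesis S_bound : forall j, S j -> (1 <= j <= k)%N.
Local Notation T := (words A k S).
Variable B : {pred A}.
Let b : R := #|B|%:R.
Let word (w : T) : seq A := val (val w).

Lemma big_tuple_cons (U : finType) m (f : m.+1.-tuple U -> R) :
  \sum_t f t = \sum_x \sum_(t : m.-tuple U) f (cons_tuple x t).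
Proof.
rewrite pair_bigA /= (reindex (fun u : U * m.-tuple U => cons_tuple u.1 u.2)) //=.
exists (fun t => (thead t, behead_tuple t)) => [[x t] _|t _] /=.
  by congr pair; apply: val_inj.
by apply: val_inj => /=; case: t => [[|x s] ].
Qed.

Lemma sum_superwords x j : all [in B] x ->
  \sum_(t : j.-tuple A) (all [in B] t && subseq x t)%:R = superwords b (size x) j.
Proof.
elim: j x => [|j IHj] x Bx.
  rewrite (bigD1 [tuple]) //= big1 ?addr0 => [|t /eqP[]]; last exact: tuple0.
  by case: x Bx.
rewrite big_tuple_cons; case: x Bx => [_|a x /= /andP[Ba Bx]].
  under eq_bigr => c _ do under eq_bigr => t _ do
    rewrite /= -andbA -mulnb natrM.
  under eq_bigr => c _ do rewrite -mulr_sumr.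
  have sum_tl : \sum_(t : j.-tuple A) (all [in B] t)%:R = superwords b 0 j.
    by rewrite -(IHj [::]) //; apply: eq_bigr => t _; rewrite sub0seq andbT.
  under eq_bigr => c _ do under eq_bigr => t _ do rewrite andbT.
  by rewrite -mulr_suml sum_tl superwords0 -natr_sum -big_mkcond /= sum1_card -exprS.
rewrite (bigD1 a) //=; congr (_ + _).
  by rewrite -IHj //; apply: eq_bigr => t _; rewrite [a \in _]Ba eqxx.
(* A first letter other than [a] matches nothing, and [B] has [b - 1] such letters. *)
have -> : b - 1 = \sum_(c | c != a) (c \in B)%:R.
  rewrite /b -sum1_card natr_sum big_mkcond (bigD1 a) //= [a \in _]Ba addrC addrK.
  by apply: eq_bigr => c _; case: (c \in B).
rewrite mulr_suml; apply: eq_bigr => c ne_ca.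
rewrite -(IHj (a :: x)) /= ?[a \in _]Ba //.
rewrite mulr_sumr; apply: eq_bigr => t _.
by rewrite eq_sym (negbTE ne_ca) -natrM mulnb andbA.
Qed.

(* Number of chains with m words on the letters of B strictly above a given word
   of length i. *)
Fixpoint chain_count (m i : nat) : R :=
  if m is m'.+1
  then \sum_(j < k.+1 | S j && (i < j)%N) superwords b i j * chain_count m' j else 1.

Lemma chain_count_eq0 m i : (0 < m)%N -> (k < m + i)%N -> chain_count m i = 0.
Proof.
elim: m i => // m IHm i _ lt_k /=; apply: big1 => j /andP[_ lt_ij].
have le_jk : (j <= k)%N by rewrite -ltnS.
rewrite IHm ?mulr0 //; lia.
Qed.

Definition chain_count_sum i := \sum_(m < k.+1) (-1) ^+ m * chain_count m i.

(** Splitting off the smallest word, of length [j], changes the sign; the empty chain contributes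
    1. *)
Lemma chain_count_sumE i : chain_count_sum i
  + \sum_(j < k.+1 | S j && (i < j)%N) superwords b i j * chain_count_sum j = 1.
Proof.
rewrite /chain_count_sum big_ord_recl /= mul1r -addrA.
rewrite -[RHS]addr0; congr (_ + _).
(* The term [m = k] vanishes: no chain of [k] words lies above a word of positive length. *)
have -> : \sum_(j < k.+1 | S j && (i < j)%N)
      superwords b i j * (\sum_(m < k.+1) (-1) ^+ m * chain_count m j)
    = \sum_(j < k.+1 | S j && (i < j)%N)
        \sum_(m < k) superwords b i j * ((-1) ^+ m * chain_count m j).
  apply: eq_bigr => j /andP[_ lt_ij]; have lt_jk := ltn_ord j.
  by rewrite big_ord_recr /= chain_count_eq0 ?mulr0 ?addr0 ?mulr_sumr //; lia.
rewrite [X in _ + X]exchange_big -big_split big1 //= => m _.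
rewrite mulr_sumr -big_split big1 //= => j _.
by rewrite exprS; ring.
Qed.

Lemma sum_words_of_size j (f : seq A -> R) : S j ->
  \sum_(w : T | size (word w) == j) f (word w) = \sum_(t : j.-tuple A) f t.
Proof.
move=> Sj; have /andP[_ le_jk] := S_bound Sj.
rewrite -big_filter -(big_map word xpredT f).
rewrite -(big_map (fun t : j.-tuple A => val t) xpredT f).
apply: perm_big; apply: uniq_perm => [||x].
- rewrite map_inj_uniq ?filter_uniq ?index_enum_uniq // => u w.
  by move=> /val_inj/val_inj.
- by rewrite map_inj_uniq ?index_enum_uniq //; apply: val_inj.
apply/mapP/mapP => [[w]|[t _ ->]].
  rewrite mem_filter => /andP[sz_w _] ->.
  by exists (Tuple sz_w); rewrite ?mem_index_enum.
have le_t : (size t <= k)%N by rewrite size_tuple.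
have S_t : S (size (Bseq le_t)) by rewrite /= size_tuple.
exists (Sub (Bseq le_t) S_t : T) => //.
by rewrite mem_filter mem_index_enum andbT /= size_tuple.
Qed.

Let above x (w : T) :=
  [&& subseq x (word w), (size x < size (word w))%N & all [in B] (word w)].

Lemma words_ltE (u w : T) :
  (u < w)%O = subseq (word u) (word w) && (size (word u) < size (word w))%N.
Proof.
rewrite lt_neqAle -[(u <= w)%O]/(subseq (word u) (word w)) andbC.
have [sub_uw|//] := boolP (subseq _ _); rewrite /= ltn_neqAle size_subseq // andbT.
congr negb; apply/eqP/eqP => [->//|eq_sz]; apply/val_inj/val_inj/eqP.
by rewrite -(geq_leqif (size_subseq_leqif sub_uw)) -[size (val (val w))]eq_sz.
Qed.

(** Without its smallest word [w], a chain is one strictly above [w]; grouping the [w] by length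
    brings in [sum_superwords]. *)
Lemma chain_countE m x : all [in B] x ->
  \sum_(t : m.-tuple T) (sorted <%O t && all (above x) t)%:R
    = chain_count m (size x).
Proof.
elim: m x => [|m IHm] x Bx.
  by rewrite (bigD1 [tuple]) //= big1 ?addr0 => [|t /eqP[]]; last exact: tuple0.
rewrite big_tuple_cons /=.
transitivity (\sum_w (above x w)%:R * chain_count m (size (word w))).
  apply: eq_bigr => w _.
  have [/and3P[sub_xw lt_xw Bw]|] := boolP (above x w); last first.
    by move=> /negbTE above_w; rewrite mul0r big1 // => t _; rewrite andbF.
  rewrite mul1r -IHm //; apply: eq_bigr => t _; congr (_%:R); congr nat_of_bool.
  rewrite (path_sortedE lt_trans) andbAC -all_predI andbC /=; congr (_ && _).
  apply: eq_all => u /=; rewrite words_ltE /above -!andbA.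
  have [sub_wu|//] := boolP (subseq (word w) _).
  rewrite (subseq_trans sub_xw sub_wu).
  have [lt_wu|//] := boolP (size (word w) < _)%N.
  by rewrite (ltn_trans lt_xw lt_wu).
pose rank (w : T) := Ordinal (size_bseq (val w) : (_ < k.+1)%N).
rewrite (partition_big rank xpredT) //=.
rewrite [RHS]big_mkcond; apply: eq_bigr => j _.
rewrite (eq_bigl (fun w => size (word w) == j)) => [|w]; last by rewrite -val_eqE.
have [Sj|nSj] /= := boolP (S j); last first.
  by rewrite big_pred0 // => w; apply: contraNF nSj => /eqP <-; apply: (valP w).
rewrite (sum_words_of_size (fun y =>
  [&& subseq x y, (size x < size y)%N & all [in B] y]%:R
  * chain_count m (size y)) Sj).
under eq_bigr do rewrite size_tuple.
rewrite -mulr_suml; case: ifP => lt_xj; last first.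
  by rewrite big1 ?mul0r // => t _; rewrite andbF.
by rewrite -sum_superwords //; congr (_ * _); apply: eq_bigr => t _; rewrite andbC.
Qed.

End ChainCounts.

(** * Lefschetz numbers of the word posets *)

Section WordsTraces.

Variables (F : fieldType) (A : finType) (k : nat) (S : pred nat).
Hypothesis S_bound : forall j, S j -> (1 <= j <= k)%N.
Local Notation T := (words A k S).
Local Notation to_homo := (@word_action_homo A k S).

Lemma card_chain_words_eq0 m : (count S (iota 1 k) < m)%N -> #|{: chain T m}| = 0%N.
Proof.
move=> lt_m; apply: eq_card0 => c; apply/negP=> _; move: lt_m; apply/negP.
rewrite -leqNgt -[leqLHS](size_tuple (val c)) -size_filter.
rewrite -(size_map (fun w : T => size (val w))).
apply: uniq_leq_size => [|_ /mapP[w _ ->]]; last first.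
  by rewrite mem_filter mem_iota (valP w) add1n ltnS; apply: S_bound (valP w).
apply: (sorted_uniq ltn_trans ltnn); rewrite sorted_map.
by apply: sub_sorted (valP c) => u w; rewrite words_ltE => /andP[].
Qed.

(** The action is entrywise on chains and on words, so being fixed passes to each word and then to
    each letter. *)
Lemma act_chain_fixed m (c : chain T m) (g : {perm A}) :
  (act_chain to_homo c g == c)
    = all (fun w : T => all [in [pred a | g a == a]] (val w : seq A)) (val c).
Proof.
have fix_word (w : T) : (word_action A k S w g == w)
    = all [in [pred a | g a == a]] (val w : seq A).
  apply/eqP/allP => [fix_w a w_a|fix_w].
    have /esym/eq_in_map : map g (val w) = map id (val w).
      by rewrite map_id -[RHS](congr1 (fun u : T => val (val u)) fix_w).
    by move/(_ a w_a) => /= fix_a; rewrite inE -fix_a.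
  apply/val_inj/val_inj => /=; rewrite -[RHS]map_id.
  by apply/eq_in_map => a /fix_w; rewrite inE => /eqP.
apply/eqP/allP => [fix_c w c_w|fix_c].
  rewrite -fix_word; apply/eqP; move: w c_w; apply/eq_in_map.
  rewrite map_id; exact: (congr1 (fun c' : chain T m => val (val c')) fix_c).
apply/val_inj/val_inj => /=; rewrite -[RHS]map_id.
by apply/eq_in_map => w /fix_c; rewrite -fix_word => /eqP.
Qed.

(** The chain module is a permutation module, so its trace counts fixed chains; these are counted
    above the empty word, of length 0. *)
Lemma mxtrace_chain_words m (g : {perm A}) :
  \tr (chain_repr F to_homo m g)
    = chain_count F k S [pred a | g a == a] m 0.
Proof.
have := @chain_countE F A k S S_bound [pred a | g a == a] m [::] isT.
move=> /= <-; rewrite /mxtrace.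
transitivity (\sum_(c : chain T m) (act_chain to_homo c g == c)%:R : F).
  rewrite (reindex _ (onW_bij _ (enum_val_bij (chain T m)))) /=.
  by apply: eq_bigr => i _; rewrite mxE.
rewrite [RHS](bigID (fun t : m.-tuple T => sorted <%O t)) /=.
rewrite [X in _ = _ + X]big1 ?addr0 => [|t /negbTE->] //.
rewrite (reindex_omap (val : chain T m -> _) insub) => [|t t_sorted]; last first.
  by rewrite insubT.
apply: eq_big => [c|c _]; first by rewrite valK eqxx (valP c).
rewrite act_chain_fixed (valP c); congr (_%:R); congr nat_of_bool.
apply: eq_all => w /=; rewrite sub0seq /=.
by have /andP[-> _] := S_bound (valP w).
Qed.

Lemma mxtrace_homology_words (g : {perm A}) m :
    (1 < #|A|)%N -> count S (iota 1 k) = k.-1 -> (0 < k)%N ->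
  \tr (words_homology_repr F A k S m g)
    = if m == k.-1
      then (-1) ^+ k.-1 * chain_count_sum F k S [pred a | g a == a] 0 else 0.
Proof.
move=> A_gt1 cardS k_gt0.
rewrite (@mxtrace_homology_concentrated _ _ _ _ _ _ k.-1 g) => [|j lt_j|j lt_j].
(* With [k - 1] lengths available no chain has [k] words, so both alternating sums run over the same
   range. *)
- have top0 : chain_count F k S [pred a | g a == a] k 0 = 0.
    rewrite -mxtrace_chain_words [LHS]big1 // => i _; move: (ltn_ord i).
    by rewrite {2}card_chain_words_eq0 // cardS ltn_predL.
  case: ifP => // _; rewrite /chain_count_sum prednK // big_ord_recr /= top0.
  rewrite mulr0 addr0 mulr_sumr; apply: eq_bigr => j _.
  have le_jk : (j <= k.-1)%N by have := ltn_ord j; lia.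
  by rewrite mxtrace_chain_words -[in RHS](subnK le_jk) exprD -mulrA signrMK.
- by apply: words_acyclic; rewrite ?cardS.
by apply: card_chain_words_eq0; rewrite cardS.
Qed.

End WordsTraces.

(** * Symmetry between the removed ranks *)

Lemma count_iota_neq k r : (0 < r <= k)%N ->
  count [pred j | (1 <= j <= k)%N && (j != r)] (iota 1 k) = k.-1.
Proof.
move=> r_k; rewrite (eq_in_count (a2 := predC (pred1 r))) => [|j]; last first.
  by rewrite mem_iota add1n ltnS /= => ->.
have := count_predC (pred1 r) (iota 1 k).
by rewrite (count_uniq_mem r (iota_uniq _ _)) mem_iota size_iota add1n ltnS r_k; lia.
Qed.

Theorem proposition19 (R : realType) (n k r : nat) (A : finType) :
  #|A| = n -> (2 <= n)%N -> (2 <= k)%N -> (1 <= r <= k - 1)%N ->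
  forall m : nat,
    mx_rsim
      (words_homology_repr R[i] A k
         [pred j | (1 <= j <= k)%N && (j != r)] m)
      (words_homology_repr R[i] A k
         [pred j | (1 <= j <= k)%N && (j != k - r)%N] m).
Proof.
move=> cardA n_gt1 k_gt1 r_bound m; apply: mx_rsim_trace => [|g _].
  exact: Num.Theory.pchar_num.
rewrite !mxtrace_homology_words ?cardA ?count_iota_neq //; try lia; last 2 first.
- by move=> j /andP[].
- by move=> j /andP[].
case: ifP => // _; congr (_ * _).
set B : {pred A} := [pred a | g a == a].
(* The removed rank [s] enters the trace only through ['C(k, s)], which is unchanged under
   [s -> k - s]. *)
have sumE s : (0 < s < k)%N ->
    chain_count_sum R[i] k [pred j | (1 <= j <= k)%N && (j != s)] B 0
    = #|B|%:R * (1 - #|B|%:R) ^+ k.-1 * 'C(k, s)%:R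
      - \sum_(j < k.+1) inv_row0 #|B|%:R j.
  move=> s_k; apply: (deleted_rank_sum s_k) => j.
  rewrite -[RHS](chain_count_sumE _ k [pred j | (1 <= j <= k)%N && (j != s)] B j).
  by congr (_ + _); apply: eq_bigl => l /=; rewrite andbA.
rewrite !sumE ?bin_sub //; lia.
Qed.
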